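(* For any $\varepsilon > 0$, there exist coprime integers $a_1, a_2, a_3$, none of which is zero, for which $$\gamma_{a_1,a_2,a_3} \leq \frac{1}{12} + \varepsilon.$$
   Context: For a finite set $S \subseteq \mathbb{Z}$, $T_{a_1,a_2,a_3}(S)$ denotes the number of triples $(x_1,x_2,x_3) \in S^3$ with $a_1x_1+a_2x_2+a_3x_3=0$. Define $$\gamma_{a_1,a_2,a_3} = \limsup_{|S|\to\infty} \frac{T_{a_1,a_2,a_3}(S)}{|S|^2},$$ where $S$ runs over finite subsets of $\mathbb{Z}$; that is, $\gamma_{a_1,a_2,a_3} = \lim_{N\to\infty} \sup\{T_{a_1,a_2,a_3}(S)/|S|^2 : S \subseteq \mathbb{Z} \text{ finite}, |S| \geq N\}$. *)

(* Defs.v *)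
From mathcomp Require Import all_boot all_order all_algebra.
From mathcomp Require Import finmap.
From mathcomp Require Import all_classical all_reals all_analysis.

Set Implicit Arguments.
Unset Strict Implicit.
Unset Printing Implicit Defensive.

Import Order.TTheory GRing.Theory Num.Theory.
Import numFieldNormedType.Exports.

Local Open Scope classical_set_scope.
Local Open Scope ring_scope.

Definition nsol (a1 a2 a3 : int) (S : {fset int}) : nat :=
  #|` [fset x in (S `*` S `*` S)%fset
      | (a1 * x.1.1 + a2 * x.1.2 + a3 * x.2 == 0)%R]%fset |.

(* For S empty the ratio is 0 / 0 = 0, which only affects the term N = 0. *)
Definition sol_ratio (R : realType) (a1 a2 a3 : int) (S : {fset int}) : R :=
  (nsol a1 a2 a3 S)%:R / #|` S|%:R ^+ 2.

(* The suprema are nonincreasing in N, so the limit always exists in \bar R. *)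
Definition gamma (R : realType) (a1 a2 a3 : int) : \bar R :=
  limn (fun N : nat =>
    ereal_sup [set (sol_ratio R a1 a2 a3 S)%:E
              | S in [set S : {fset int} | (N <= #|` S|)%N]]).

(* Main.v *)
(** The coefficients are 1, p, p^5 for a huge prime p, so that the equation reads
    y1 + y2 + y3 = e on the sets A = S, B = pS, C = p^5 S.  View a finite set of
    integers as a tree of residues modulo p, p^2, ...  Splitting A, B, C into
    residues mod p splits the solutions into triples of children with r + s + t = e,
    and the potential |A| sqrt(|B||C|) + |B| sqrt(|A||C|) + |C| sqrt(|A||B|)
    decreases under such a splitting.  It drops by a fixed proportion unless each
    set has one child carrying almost everything or the splitting is nearly flat:
    few residues behave like integers, where a set and its translate differ by a
    fixed proportion once the translation exceeds the width of the set.  Hence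
    splits into neither one nor very many children occur rarely along solutions,
    and by pigeonhole over a rapidly decreasing sequence of thresholds all but
    eps |S|^2 solutions are such that the first flat split happens at the same
    level k for y1, y2, y3.  Multiplication by p shifts this level by one, so that
    colouring x by its level in S modulo 12 gives x1, x2, x3 the colours
    d, d - 1, d - 5.

    For sets of integers of sizes a, b, c an extremal (hook) argument bounds the
    number of solutions by (ab + bc + ca + 1) / 4.  Summing over d, the pairs of
    colours that occur form a simple tripartite graph, whose weighted number of
    edges is at most |S|^2 / 3; the total is |S|^2 / 12 + 3. *)
Require Import Defs.
From mathcomp Require Import all_boot all_order all_algebra.
From mathcomp Require Import finmap.
From mathcomp Require Import all_classical all_reals all_analysis.
From mathcomp Require Import zify ring lra.

Import Order.TTheory GRing.Theory Num.Theory.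
Import numFieldNormedType.Exports.

Local Open Scope ring_scope.

(** * Triple sums and almost invariant weights *)

(** A largest of the three is at least one of the others, and the matching implication makes it
    nonpositive. In [concentrated] the numbers are the widths of three sets. *)
Lemma le0_of_chains (x y z : int) :
  (x <= y -> y <= 0) -> (y <= x -> x <= 0) -> (x <= z -> z <= 0) ->
  (z <= y -> y <= 0) -> (z <= x -> x <= 0) -> (y <= z -> z <= 0) ->
  [/\ x <= 0, y <= 0 & z <= 0].
Proof. by move=> *; split; lia. Qed.

Section TripleSums.
Variables (F : finZmodType) (R : realFieldType).
Implicit Types (a b g : F -> R) (c : F) (w : F -> F -> F -> R).

Definition tsum c w : R := \sum_r \sum_s w r s (c - r - s).

Lemma eq_tsum c w w' : (forall r s t, r + s + t = c -> w r s t = w' r s t) ->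
  tsum c w = tsum c w'.
Proof.
move=> e; apply: eq_bigr => r _; apply: eq_bigr => s _; apply: e.
by rewrite addrC -[c - r - s]addrA -opprD subrK.
Qed.

Lemma tsum_swap12 c w : tsum c w = tsum c (fun r s t => w s r t).
Proof.
rewrite /tsum exchange_big; apply: eq_bigr => r _; apply: eq_bigr => s _.
by rewrite addrAC.
Qed.

Lemma tsum_swap23 c w : tsum c w = tsum c (fun r s t => w r t s).
Proof.
apply: eq_bigr => r _.
rewrite [LHS](reindex_inj (h := fun s => c - r - s)); last first.
  by move=> x y /= /addrI /oppr_inj.
by apply: eq_bigr => s _; rewrite opprB addrCA subrr addr0.
Qed.

Lemma ler_tsum c w w' : (forall r s t, r + s + t = c -> w r s t <= w' r s t) ->
  tsum c w <= tsum c w'.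
Proof.
move=> e; apply: ler_sum => r _; apply: ler_sum => s _; apply: e.
by rewrite addrC -[c - r - s]addrA -opprD subrK.
Qed.

Lemma tsumD c w w' :
  tsum c (fun r s t => w r s t + w' r s t) = tsum c w + tsum c w'.
Proof.
by rewrite /tsum -big_split; apply: eq_bigr => r _; rewrite -big_split.
Qed.

Lemma tsumZ c k w : tsum c (fun r s t => k * w r s t) = k * tsum c w.
Proof.
by rewrite /tsum mulr_sumr; apply: eq_bigr => r _; rewrite mulr_sumr.
Qed.

Lemma tsum_sum c n (w : 'I_n -> F -> F -> F -> R) :
  tsum c (fun r s t => \sum_j w j r s t) = \sum_j tsum c (w j).
Proof.
rewrite /tsum [RHS]exchange_big /=; apply: eq_bigr => r _.
by rewrite [RHS]exchange_big.
Qed.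

Definition deg b g c r : R := \sum_s b s * g (c - r - s).

Definition subunit a := (forall r, 0 <= a r) /\ \sum_r a r ^+ 2 <= 1.

(** When [a], [b], [g] are the square roots of the relative sizes of children, this is the
    proportion of one of the three terms of the potential that survives the splitting. *)
Definition affinity a b g c : R := \sum_r a r ^+ 2 * deg b g c r.

Lemma degC b g c r : deg b g c r = deg g b c r.
Proof.
rewrite /deg [LHS](reindex_inj (h := fun s => c - r - s)) /=.
  by apply: eq_bigr => s _; rewrite opprB addrCA subrr addr0 mulrC.
by move=> x y /= /addrI /oppr_inj.
Qed.

Lemma affinityE a b g c :
  affinity a b g c = tsum c (fun r s t => a r ^+ 2 * (b s * g t)).
Proof. by apply: eq_bigr => r _; rewrite mulr_sumr. Qed.

Lemma affinityC a b g c : affinity a b g c = affinity a g b c.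
Proof. by apply: eq_bigr => r _; rewrite degC. Qed.

Lemma sum_shift (h : F -> R) d : \sum_s h (s + d) = \sum_s h s.
Proof. by rewrite [RHS](reindex_inj (addIr d)). Qed.

Lemma sum_refl (h : F -> R) d : \sum_s h (d - s) = \sum_s h s.
Proof.
rewrite [RHS](reindex_inj (h := fun s => d - s)) //.
by move=> x y /= /addrI /oppr_inj.
Qed.

Lemma dot_dist (u v : F -> R) k : \sum_s u s ^+ 2 <= 1 -> \sum_s v s ^+ 2 <= 1 ->
  1 - k <= \sum_s u s * v s -> \sum_s (u s - v s) ^+ 2 <= 2 * k.
Proof.
move=> hu hv h.
have -> : \sum_s (u s - v s) ^+ 2 =
    \sum_s u s ^+ 2 + \sum_s v s ^+ 2 - 2 * \sum_s u s * v s.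
  rewrite mulr_sumr -!big_split -sumrB /=; apply: eq_bigr => s _; ring.
lra.
Qed.

(** For vectors of norm at most 1 the inner product is at most 1 minus half the squared distance;
    only the coordinate [s] of that distance is kept. So one pair of children of unequal relative
    size already costs degree. *)
Lemma deg_le b g c r s : subunit b -> subunit g ->
  deg b g c r <= 1 - (b s - g (c - r - s)) ^+ 2 / 2.
Proof.
move=> [_ hb] [_ hg].
rewrite -lerBlDr opprK; set k := _ / 2.
have hgs : \sum_s g (c - r - s) ^+ 2 <= 1.
  by rewrite (sum_refl (fun s => g s ^+ 2)).
have := @dot_dist b (fun s => g (c - r - s)) (1 - deg b g c r) hb hgs.
rewrite subKr => /(_ (lexx _)).
rewrite (bigD1 s) //= => h.
have : 0 <= \sum_(i | i != s) (b i - g (c - r - i)) ^+ 2.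
  by apply: sumr_ge0 => i _; apply: sqr_ge0.
move: h; rewrite /k; set x := (b s - _) ^+ 2; set y := \sum_(i | _) _; lra.
Qed.

Lemma deg_le1 b g c r : subunit b -> subunit g -> deg b g c r <= 1.
Proof.
move=> hb hg; apply: (le_trans (deg_le b g c r r hb hg)).
by rewrite lerBlDr lerDl divr_ge0 ?sqr_ge0.
Qed.

Lemma deg_ge0 b g c r : subunit b -> subunit g -> 0 <= deg b g c r.
Proof.
by move=> [hb _] [hg _]; apply: sumr_ge0 => s _; rewrite mulr_ge0.
Qed.

Lemma affinity_le1 a b g c :
  subunit a -> subunit b -> subunit g -> affinity a b g c <= 1.
Proof.
move=> [ha0 ha] hb hg; apply: le_trans ha; apply: ler_sum => r _.
by rewrite ler_piMr ?sqr_ge0 ?deg_le1.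
Qed.

(* If two shifts of g match the same a well, then a is almost invariant under
   twice the difference d of the shifts, which moves the bulk of a off itself
   once d is at least as long as that bulk. *)
Lemma narrow_contra a g c (G : {set F}) s1 s2 (f : F -> int) :
  subunit a -> subunit g ->
  9/10 <= \sum_(r in G) a r ^+ 2 ->
  99/100 <= deg a g c s1 -> 99/100 <= deg a g c s2 ->
  (forall r r', r \in G -> r' \in G -> f r - f r' <= f s2 - f s1) ->
  0 < f s2 - f s1 ->
  (forall r, r \in G -> r + (s2 - s1) + (s2 - s1) \in G ->
     f (r + (s2 - s1) + (s2 - s1)) - f r = (f s2 - f s1) + (f s2 - f s1)) ->
  False.
Proof.
move=> [ha0 ha] [hg0 hg] hG h1 h2 hf D0 hrect.
set d := s2 - s1 in hrect *.
pose w r := g (c - s1 - r).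
have hw : \sum_r w r ^+ 2 <= 1 by rewrite (sum_refl (fun r => g r ^+ 2)).
have hwd : \sum_r w (r + d) ^+ 2 <= 1 by rewrite (sum_shift (fun r => w r ^+ 2)).
have e1 : \sum_r (a r - w r) ^+ 2 <= 2 / 100.
  have := @dot_dist a w (1/100) ha hw.
  have -> : 1 - 1/100 = 99/100 :> R by lra.
  by move=> /(_ h1); lra.
have e2 : \sum_r (a r - w (r + d)) ^+ 2 <= 2 / 100.
  have := @dot_dist a (fun r => w (r + d)) (1/100) ha hwd.
  have -> : 1 - 1/100 = 99/100 :> R by lra.
  have -> : \sum_s a s * w (s + d) = deg a g c s2.
    apply: eq_bigr => s _; rewrite /w /d; congr (_ * g _).
    by rewrite [s + _]addrC opprD opprB addrA addrA subrK.
  by move=> /(_ h2); lra.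
have e3 : \sum_r (a (r + d) - w (r + d)) ^+ 2 <= 2 / 100.
  by rewrite (sum_shift (fun r => (a r - w r) ^+ 2)).
(* Both [a] and its translate by [d] are close to the same translate of [g]. The squared triangle
   inequality gives 2 * 2 + 2 * 2 = 8 here and 2 * 8 + 2 * 8 = 32 for the translate by [d + d]. *)
have e4 : \sum_r (a r - a (r + d)) ^+ 2 <= 8 / 100.
  apply: (@le_trans _ _ (2 * \sum_r (a r - w (r + d)) ^+ 2 +
    2 * \sum_r (a (r + d) - w (r + d)) ^+ 2)); last lra.
  rewrite !mulr_sumr -big_split; apply: ler_sum => r _ /=.
  have := sqr_ge0 (a r - w (r + d) + (a (r + d) - w (r + d))); lra.
have e5 : \sum_r (a (r + d) - a (r + d + d)) ^+ 2 <= 8 / 100.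
  by rewrite (sum_shift (fun r => (a r - a (r + d)) ^+ 2)).
have e6 : \sum_r (a r - a (r + d + d)) ^+ 2 <= 32 / 100.
  apply: (@le_trans _ _ (2 * \sum_r (a r - a (r + d)) ^+ 2 +
    2 * \sum_r (a (r + d) - a (r + d + d)) ^+ 2)); last lra.
  rewrite !mulr_sumr -big_split; apply: ler_sum => r _ /=.
  have := sqr_ge0 (a r - a (r + d) - (a (r + d) - a (r + d + d))); lra.
have e7 : \sum_(r in G) (a r - a (r + d + d)) ^+ 2 <= 32 / 100.
  apply: le_trans e6; rewrite big_mkcond; apply: ler_sum => r _.
  by case: ifP => // _; apply: sqr_ge0.
(* Translation by [d + d] moves [f] by twice the bound on the width of [G], hence moves [G] off
   itself into the complement, whose mass is at most 1/10. The contradiction is then 9/10 <= 64/100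
   + 20/100. *)
have e8 : \sum_(r in G) a (r + d + d) ^+ 2 <= 1/10.
  have : \sum_(r in G) a (r + d + d) ^+ 2 <= \sum_(r | r \notin G) a r ^+ 2.
    rewrite big_mkcond [X in _ <= X]big_mkcond.
    rewrite -[X in _ <= X](sum_shift _ d) -[X in _ <= X](sum_shift _ d).
    apply: ler_sum => r _; case: ifP => rG; last by case: ifP; rewrite ?sqr_ge0.
    case: ifPn => // /negPn rG2.
    have := hrect r rG rG2; have := hf _ _ rG2 rG.
    by move=> h e; move: h; rewrite e gerDl leNgt D0.
  have := ha; rewrite (bigID (mem G)) /=; lra.
have : \sum_(r in G) a r ^+ 2 <= 2 * \sum_(r in G) (a r - a (r + d + d)) ^+ 2 +
    2 * \sum_(r in G) a (r + d + d) ^+ 2.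
  rewrite !mulr_sumr -big_split; apply: ler_sum => r _ /=.
  have := sqr_ge0 (a r - a (r + d + d) - a (r + d + d)); lra.
lra.
Qed.

Definition good a b g c := [set r | (0 < a r) && (99/100 <= deg b g c r)].

(** Markov's inequality: residues that are not good have degree at most 99/100 or weight 0, so
    999/1000 <= 99/100 + G/100 for the good mass G. *)
Lemma good_mass a b g c : subunit a -> subunit b -> subunit g ->
  1 - 1/1000 <= affinity a b g c -> 9/10 <= \sum_(r in good a b g c) a r ^+ 2.
Proof.
move=> [ha0 ha] hb hg h.
have : affinity a b g c <= 99/100 * (\sum_r a r ^+ 2) +
    1/100 * \sum_(r in good a b g c) a r ^+ 2.
  rewrite !mulr_sumr [X in _ <= _ + X]big_mkcond -big_split.
  apply: ler_sum => r _ /=; have a0 := ha0 r.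
  have := deg_le1 _ _ c r hb hg; have a2 := sqr_ge0 (a r).
  rewrite inE; case: ifPn => [_ d1|]; first by nra.
  rewrite negb_and -leNgt -ltNge => /orP[a0'|d1 _]; last by nra.
  by have -> : a r = 0; [lra|move=> _; rewrite expr0n /= mul0r mulr0 addr0].
lra.
Qed.

Lemma widest (G : {set F}) (f : F -> int) : G != finset.set0 ->
  exists r1 r2, [/\ r1 \in G, r2 \in G &
   forall r r', r \in G -> r' \in G -> f r - f r' <= f r2 - f r1].
Proof.
case/set0Pn => r0 r0G.
have [r1 r1G h1] := @arg_minP _ _ F r0 (mem G) f r0G.
have [r2 r2G h2] := @arg_maxP _ _ F r0 (mem G) f r0G.
exists r1, r2; split=> // r r' rG r'G.
by apply: lerB; [apply: h2|apply: h1].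
Qed.

(** A relative of a Freiman isomorphism into the integers: a double step by [d] in one place is
    twice a single step by [d] in another, which is the relation that [narrow_contra] applies to [G]
    and the two shifts. *)
Definition rectified (X : {set F}) (f : F -> int) :=
  {in X &, injective f} /\
  forall r s d, r \in X -> s \in X -> r + d + d \in X -> s + d \in X ->
    f (r + d + d) - f r = (f (s + d) - f s) + (f (s + d) - f s).

Lemma good_supp a b g c r : r \in good a b g c -> 0 < a r.
Proof. by rewrite inE => /andP[]. Qed.

(** If one good set is at most as wide as another, the two extreme points of the wider one serve as
    shifts in [narrow_contra], unless its width is 0. So a widest good set, and with it all three,
    is a single point, which carries the whole good mass 9/10. *)
Lemma concentrated a b g c (X : {set F}) f :
  subunit a -> subunit b -> subunit g -> rectified X f ->
  (forall r, 0 < a r -> r \in X) -> (forall r, 0 < b r -> r \in X) ->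
  (forall r, 0 < g r -> r \in X) ->
  1 - 1/1000 <= affinity a b g c -> 1 - 1/1000 <= affinity b a g c ->
  1 - 1/1000 <= affinity g a b c ->
  [/\ exists r, 9/10 <= a r ^+ 2, exists s, 9/10 <= b s ^+ 2 &
      exists t, 9/10 <= g t ^+ 2].
Proof.
move=> ha hb hg [finj frect] hXa hXb hXg h1 h2 h3.
have m1 := good_mass _ _ _ _ ha hb hg h1.
have m2 := good_mass _ _ _ _ hb ha hg h2.
have m3 := good_mass _ _ _ _ hg ha hb h3.
have ne x y z : 9/10 <= \sum_(r in good x y z c) x r ^+ 2 -> good x y z c != finset.set0.
  by move=> h; apply/eqP => e; move: h; rewrite e big_set0; lra.
have [r1 [r2 [r1G r2G hr]]] := widest _ f (ne _ _ _ m1).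
have [s1 [s2 [s1G s2G hs]]] := widest _ f (ne _ _ _ m2).
have [t1 [t2 [t1G t2G ht]]] := widest _ f (ne _ _ _ m3).
have key x y z (G : {set F}) D y1 y2 (hx : subunit x) (hz : subunit z) :
    {subset G <= X} -> 9/10 <= \sum_(r in G) x r ^+ 2 ->
    (forall r r', r \in G -> r' \in G -> f r - f r' <= D) ->
    (forall r, 0 < y r -> r \in X) ->
    y1 \in good y x z c -> y2 \in good y x z c ->
    D <= f y2 - f y1 -> f y2 - f y1 <= 0.
  move=> GX mx hxx hXy y1G y2G hD; rewrite leNgt; apply/negP => D0.
  apply: (narrow_contra x z c G y1 y2 f hx hz mx) => //.
  - by move: y1G; rewrite inE => /andP[].
  - by move: y2G; rewrite inE => /andP[].
  - by move=> r r' rG r'G; apply: le_trans hD; apply: hxx.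
  - move=> r rG rG2.
    have e : y1 + (y2 - y1) = y2 by rewrite addrC subrK.
    have := frect r y1 (y2 - y1); rewrite e; apply; try exact: GX.
    + exact/hXy/(good_supp _ _ _ _ _ y1G).
    + exact/hXy/(good_supp _ _ _ _ _ y2G).
have gC x y z : good x y z c = good x z y c.
  by apply/setP => r; rewrite !inE degC.
have GXr : {subset good a b g c <= X} by move=> r /good_supp /hXa.
have GXs : {subset good b a g c <= X} by move=> r /good_supp /hXb.
have GXt : {subset good g a b c <= X} by move=> r /good_supp /hXg.
have krs := key a b g _ _ s1 s2 ha hg GXr m1 hr hXb s1G s2G.
have ksr := key b a g _ _ r1 r2 hb hg GXs m2 hs hXa r1G r2G.
have krt := key a g b _ _ t1 t2 ha hb GXr m1 hr hXg t1G t2G.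
have kts := key g b a _ _ s1 s2 hg ha GXt m3 ht hXb.
rewrite gC in kts; move: kts => /(_ s1G s2G) kts.
have ktr := key g a b _ _ r1 r2 hg hb GXt m3 ht hXa.
rewrite gC in ktr; move: ktr => /(_ r1G r2G) ktr.
have kst := key b g a _ _ t1 t2 hb ha GXs m2 hs hXg.
rewrite gC in kst; move: kst => /(_ t1G t2G) kst.
have [Dr Ds Dt] := le0_of_chains _ _ _ krs ksr krt kts ktr kst.
have single x (G : {set F}) D r0 : {subset G <= X} ->
    9/10 <= \sum_(r in G) x r ^+ 2 -> r0 \in G ->
    (forall r r', r \in G -> r' \in G -> f r - f r' <= D) -> D <= 0 ->
    exists r, 9/10 <= x r ^+ 2.
  move=> GX mx r0G hG D0; exists r0; apply: (le_trans mx).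
  rewrite (bigD1 r0) //= big1 ?addr0 // => r /andP[rG /eqP []].
  apply: finj; try exact: GX.
  apply: le_anti; rewrite -subr_le0 -[X in _ && X]subr_le0.
  by apply/andP; split; apply: le_trans D0; apply: hG.
by split; [apply: single GXr m1 r1G hr Dr|apply: single GXs m2 s1G hs Ds|
  apply: single GXt m3 t1G ht Dt].
Qed.
End TripleSums.

(** * Rectification of small sets of residues modulo a prime *)

Lemma Fp_intr_eq0 (p : nat) (z : int) : prime p ->
  ((z%:~R : 'F_p) == 0) = (p %| z)%Z.
Proof.
move=> pp; case: (intP z) => [|n|n].
- by rewrite dvdz0 mulr0z eqxx.
- by rewrite -pmulrn dvdzE /= (dvdn_pcharf (pchar_Fp pp)).
- by rewrite mulrNz oppr_eq0 -pmulrn dvdzE abszN /= (dvdn_pcharf (pchar_Fp pp)).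
Qed.

Lemma small_dvdz (p : nat) (z : int) : (p %| z)%Z -> (`|z| < p)%N -> z = 0.
Proof.
rewrite dvdzE /= => /dvdn_leq h zp; apply/eqP; rewrite -absz_eq0 -leqn0 leqNgt.
by apply/negP => z0; move: (h z0); rewrite leqNgt zp.
Qed.

Lemma same_box_close (p m1 m2 : nat) : (0 < p)%N ->
  (16 * m1 %/ p = 16 * m2 %/ p)%N -> (`|m1%:Z - m2%:Z| * 16 < p)%N.
Proof.
move=> p0 e; have := divn_eq (16 * m1) p; have := divn_eq (16 * m2) p.
have := ltn_pmod (16 * m1) p0; have := ltn_pmod (16 * m2) p0.
rewrite e; lia.
Qed.

(* Dirichlet: some nonzero dilate of X lies in (-p/16, p/16). *)
Lemma rectify (p : nat) (X : {set 'F_p}) : prime p -> (16 ^ #|X| < p)%N ->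
  exists f, rectified 'F_p X f.
Proof.
move=> pp hp.
have p0 : (0 < p)%N by exact: prime_gt0.
have vlt (v : 'F_p) : (val v < p)%N.
  by rewrite -[X in (_ < X)%N](Fp_cast pp); exact: ltn_ord.
have box_lt (v : 'F_p) : (16 * val v %/ p < 16)%N.
  by rewrite ltn_divLR // ltn_pmul2l.
(* A dilation [v] is recorded by which of 16 intervals of length p/16 contains each [v * x]. There
   are fewer patterns than dilations, so two of them agree, and their difference is the dilation
   behind [f]. *)
pose box (v : 'F_p) : {ffun 'I_#|X| -> 'I_16} :=
  [ffun i => Ordinal (box_lt (v * enum_val i))].
have /injectivePn[v1 [v2 v12 hbox]] : ~~ injectiveb box.
  apply/negP => /injectiveP /leq_card.
  by rewrite card_ffun (card_Fp pp) !card_ord leqNgt hp.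
pose f (x : 'F_p) : int := (val (v1 * x))%:Z - (val (v2 * x))%:Z.
have natF (v : 'F_p) : ((val v)%:Z)%:~R = v by rewrite -pmulrn; exact: natr_Zp.
have fx (x : 'F_p) : (f x)%:~R = (v1 - v2) * x.
  rewrite /f rmorphB mulrBl.
  by congr (_ - _); apply: natF.
have small x : x \in X -> (`|f x| * 16 < p)%N.
  move=> xX; move/ffunP/(_ (enum_rank_in xX x)): (hbox).
  rewrite !ffunE !enum_rankK_in // => /(congr1 val); exact: same_box_close.
have v0 : v1 - v2 != 0 by rewrite subr_eq0.
exists f; split.
  move=> x y xX yX e; apply: (mulfI v0); by rewrite -!fx e.
move=> r s d rX sX rX' sX'; apply/eqP; rewrite -subr_eq0; apply/eqP.
(* The two sides agree modulo [p], and their difference is a signed sum of six values of [f], each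
   below p/16 in absolute value. *)
apply: (@small_dvdz p).
  have intrB4 (u v x y : int) :
      (u - v - (x - y + (x - y)))%:~R = u%:~R - v%:~R - (x%:~R - y%:~R + (x%:~R - y%:~R))
      :> 'F_p by rewrite !(rmorphD, rmorphN).
  rewrite -Fp_intr_eq0 // intrB4 !fx; apply/eqP; ring.
move: (small _ rX) (small _ sX) (small _ rX') (small _ sX'); clear; lia.
Qed.

(** * One splitting of a triple of sets *)

Ltac eqle := rewrite le_eqVlt; apply/orP; left; apply/eqP.

Ltac nonneg := repeat match goal with
  | |- is_true (0 <= _) => done
  | |- is_true (0 <= _ * _) => apply: mulr_ge0
  | |- is_true (0 <= _ + _) => apply: addr_ge0
  | |- is_true (0 <= _ ^+ 2) => apply: sqr_ge0
  | |- is_true (0 <= _ ^+ _) => apply: exprn_ge0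
  | |- is_true (0 <= _^-1) => rewrite invr_ge0
  | |- is_true (0 <= _) => first [done | apply: ltW; done | apply: ler0n]
  end.

Section LocalAnalysis.
Variables (F : finZmodType) (R : realFieldType) (c : F) (rho : R).
Hypotheses (rho0 : 0 < rho) (rho1 : rho <= 1/2).
Implicit Types (a b g : F -> R) (tau : F -> F -> F -> R) (x y z : R).

Definition unitv a := (forall r, 0 <= a r) /\ \sum_r a r ^+ 2 = 1.

(** Discarding small children leaves fewer than 1/rho residues, few enough to be rectified. *)
Definition trunc a r := if rho < a r ^+ 2 then a r else 0.

Lemma trunc_ge0 a r : unitv a -> 0 <= trunc a r.
Proof. by case=> a0 _; rewrite /trunc; case: ifP. Qed.

Lemma trunc_sqr_le a r : trunc a r ^+ 2 <= a r ^+ 2.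
Proof. by rewrite /trunc; case: ifP => // _; rewrite expr0n sqr_ge0. Qed.

Lemma trunc_subunit a : unitv a -> subunit F R (trunc a).
Proof.
move=> ha; split=> [r|]; first exact: trunc_ge0.
by case: ha => _ <-; apply: ler_sum => r _; apply: trunc_sqr_le.
Qed.

Lemma unitv_le1 a r : unitv a -> a r ^+ 2 <= 1.
Proof.
move=> [_ <-]; rewrite (bigD1 r) //= lerDl.
by apply: sumr_ge0 => s _; apply: sqr_ge0.
Qed.

Lemma unitv_off a r : unitv a -> \sum_(s | s != r) a s ^+ 2 = 1 - a r ^+ 2.
Proof. by move=> [_ <-]; rewrite [in RHS](bigD1 r) //= addrAC subrr add0r. Qed.

Lemma unitv_subunit a : unitv a -> subunit F R a.
Proof. by move=> [a0 e]; split=> //; rewrite e. Qed.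

Local Notation aff a b g := (affinity F R (trunc a) (trunc b) (trunc g) c).

(* With sizes f_i^4 this is the drop of
   f1^2 f2^2 f3^2 (f1^2 + f2^2 + f3^2) when a triple of sets is replaced by the
   triples of children on which all three relative sizes exceed rho. *)
Definition loss a b g x y z : R := x ^+ 2 * y ^+ 2 * z ^+ 2 *
  (x ^+ 2 * (1 - aff a b g) + y ^+ 2 * (1 - aff b a g)
   + z ^+ 2 * (1 - aff g a b)).

Lemma loss_swap12 a b g x y z : loss a b g x y z = loss b a g y x z.
Proof. by rewrite /loss (affinityC _ _ _ (trunc a) (trunc b)); ring. Qed.

Lemma loss_swap23 a b g x y z : loss a b g x y z = loss a g b x z y.
Proof.
rewrite /loss (affinityC _ _ (trunc a)) (affinityC _ _ (trunc b)).
by rewrite (affinityC _ _ (trunc g)); ring.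
Qed.

(** [tau] stands for the number of solutions in a triple of children. Two variables of the equation
    determine the third, so the product of any two child sizes is a bound. Sizes are fourth powers
    so that all square roots that occur become monomials. *)
Definition capped tau a b g x y z := forall r s t, r + s + t = c ->
  [/\ 0 <= tau r s t,
      tau r s t <= x ^+ 4 * y ^+ 4 * (a r ^+ 2 * b s ^+ 2),
      tau r s t <= x ^+ 4 * z ^+ 4 * (a r ^+ 2 * g t ^+ 2) &
      tau r s t <= y ^+ 4 * z ^+ 4 * (b s ^+ 2 * g t ^+ 2)].

Lemma capped_swap12 tau a b g x y z : capped tau a b g x y z ->
  capped (fun r s t => tau s r t) b a g y x z.
Proof.
move=> h r s t e; have [] := h s r t; first by rewrite -e [s + r]addrC.
by move=> h0 h1 h2 h3; split=> //; lra.
Qed.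

Lemma capped_swap23 tau a b g x y z : capped tau a b g x y z ->
  capped (fun r s t => tau r t s) a g b x z y.
Proof.
move=> h r s t e; have [] := h r t s; first by rewrite -e addrAC.
by move=> h0 h1 h2 h3; split=> //; lra.
Qed.

Lemma aff_le1 a b g : unitv a -> unitv b -> unitv g -> aff a b g <= 1.
Proof. by move=> *; apply: affinity_le1; apply: trunc_subunit. Qed.

(** The weights on the left are those of [a] itself: mass removed by the truncation is missing from
    the affinity altogether, which only enlarges the gap. *)
Lemma affinity_gap a b g (e : F -> R) : unitv a -> unitv b -> unitv g ->
  (forall r, deg F R (trunc b) (trunc g) c r <= 1 - e r) ->
  \sum_r a r ^+ 2 * e r <= 1 - aff a b g.
Proof.
move=> ha hb hg he; rewrite lerBrDr -lerBrDl.
rewrite -[X in _ <= X - _](proj2 ha) -sumrB; apply: ler_sum => r _.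
rewrite -[X in _ <= X - _]mulr1 -mulrBr; apply: ler_pM => //.
- exact: sqr_ge0.
- by apply: deg_ge0; apply: trunc_subunit.
- exact: trunc_sqr_le.
Qed.

(** The geometric mean of the two caps that involve [a]. *)
Lemma cap_geom tau a b g x y z : 0 < x -> 0 < y -> 0 < z ->
  unitv a -> unitv b -> unitv g -> capped tau a b g x y z ->
  forall r s t, r + s + t = c ->
  tau r s t <= x ^+ 4 * y ^+ 2 * z ^+ 2 * (a r ^+ 2 * (b s * g t)).
Proof.
move=> x0 y0 z0 [a0 _] [b0 _] [g0 _] h r s t /h[t0 h1 h2 _].
rewrite -ler_sqr ?nnegrE //; last by nonneg.
apply: (@le_trans _ _ (x ^+ 4 * y ^+ 4 * (a r ^+ 2 * b s ^+ 2) *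
  (x ^+ 4 * z ^+ 4 * (a r ^+ 2 * g t ^+ 2)))).
  by rewrite expr2; apply: ler_pM.
by eqle; ring.
Qed.

Lemma tsum_cap tau a b g x y z : 0 < x -> 0 < y -> 0 < z ->
  unitv a -> unitv b -> unitv g -> capped tau a b g x y z ->
  tsum F R c tau <= x ^+ 4 * y ^+ 2 * z ^+ 2.
Proof.
move=> x0 y0 z0 ha hb hg h.
apply: (@le_trans _ _ (x ^+ 4 * y ^+ 2 * z ^+ 2 * affinity F R a b g c)).
  rewrite affinityE -tsumZ; apply: ler_tsum => r s t e.
  exact: (cap_geom tau a b g x y z).
apply: ler_piMr; first by nonneg.
by apply: affinity_le1; apply: unitv_subunit.
Qed.

Lemma trunc_gap a g r t h l : unitv a -> unitv g -> rho <= h -> l <= h / 4 ->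
  h < a r ^+ 2 -> g t ^+ 2 <= l -> h / 4 <= (trunc a r - trunc g t) ^+ 2.
Proof.
move=> ha hg rh lh hr hl.
have -> : trunc a r = a r by rewrite /trunc (le_lt_trans rh hr).
have := trunc_ge0 g t hg; have := trunc_sqr_le g t; have := proj1 ha r.
set u := a r in hr *; set v := trunc g t => u0 v1 v0.
have vu : v <= u / 2 by rewrite -ler_sqr ?nnegrE; nra.
nra.
Qed.

(** A relative size above [h] against one at most [l <= h / 4] makes the square roots differ by at
    least half the root of [h], so by [deg_le] each such [s] loses degree [h / 8]. *)
Lemma mixed_gap a b g h l : unitv a -> unitv b -> unitv g -> rho <= h ->
  l <= h / 4 ->
  h / 8 * (\sum_(s | [exists r, (h < a r ^+ 2) && (g (c - s - r) ^+ 2 <= l)])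
     b s ^+ 2) <= 1 - aff b a g.
Proof.
move=> ha hb hg rh lh.
pose P s := [exists r, (h < a r ^+ 2) && (g (c - s - r) ^+ 2 <= l)].
have gap := affinity_gap b a g (fun s => if P s then h / 8 else 0) hb ha hg.
apply: le_trans (gap _) => [|s].
  rewrite big_mkcond mulr_sumr; apply: ler_sum => s _; rewrite -/(P s).
  by case: ifP => _; rewrite ?mulr0 // mulrC.
case: ifPn => [/existsP[r /andP[hr hl]]|_]; last first.
  by rewrite subr0; apply: deg_le1; apply: trunc_subunit.
apply: (le_trans (deg_le _ _ _ _ c s r (trunc_subunit _ ha) (trunc_subunit _ hg))).
have := trunc_gap a g _ _ h l ha hg rh lh hr hl; lra.
Qed.

Lemma loss_ge a b g x y z u v w :
  u <= 1 - aff a b g -> v <= 1 - aff b a g -> w <= 1 - aff g a b ->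
  x ^+ 2 * y ^+ 2 * z ^+ 2 * (x ^+ 2 * u + y ^+ 2 * v + z ^+ 2 * w)
  <= loss a b g x y z.
Proof.
move=> hu hv hw; rewrite /loss; apply: ler_wpM2l; first by nonneg.
by do 2?[apply: lerD]; (apply: ler_wpM2l; first exact: sqr_ge0).
Qed.

Lemma loss_ge0 a b g x y z : unitv a -> unitv b -> unitv g ->
  0 <= loss a b g x y z.
Proof.
move=> ha hb hg; apply: le_trans (loss_ge a b g x y z 0 0 0 _ _ _).
- by rewrite !mulr0 !addr0 mulr0.
- by rewrite subr_ge0 aff_le1.
- by rewrite subr_ge0 aff_le1.
- by rewrite subr_ge0 aff_le1.
Qed.

Lemma card_heavy a h : unitv a -> 0 < h ->
  \sum_(r | h < a r ^+ 2) 1 <= h^-1 :> R.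
Proof.
move=> [_ e] h0; apply: (@le_trans _ _ ((\sum_r a r ^+ 2) / h)); last first.
  by rewrite e mul1r.
rewrite mulr_suml big_mkcond; apply: ler_sum => r _; case: ifP => hr; last by rewrite divr_ge0 ?sqr_ge0 ?ltW.
by rewrite ler_pdivlMr // mul1r ltW.
Qed.

(** Both light children cost degree by [mixed_gap]; [U] and [V] below are the masses that pay. If
    [k * (y * z) <= x ^+ 2], the cap through [b] and [g] gains a factor [l], and at most [h^-1]
    residues [r] are heavy; otherwise the geometric cap through [a] suffices. *)
Lemma mixed_heavy_light_light tau a b g x y z h l k :
  0 < x -> 0 < y -> 0 < z -> unitv a -> unitv b -> unitv g ->
  capped tau a b g x y z -> rho <= h -> l <= h / 4 -> 0 <= k -> l <= k ^+ 2 * h ->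
  tsum F R c (fun r s t =>
    if [&& h < a r ^+ 2, b s ^+ 2 <= l & g t ^+ 2 <= l] then tau r s t else 0)
  <= 4 * k / h * loss a b g x y z.
Proof.
move=> x0 y0 z0 ha hb hg hc rh lh k0 lk.
have h0 : 0 < h by apply: lt_le_trans rh.
pose P s := [exists r, (h < a r ^+ 2) && (g (c - s - r) ^+ 2 <= l)].
pose Q t := [exists r, (h < a r ^+ 2) && (b (c - t - r) ^+ 2 <= l)].
have hP := mixed_gap a b g h l ha hb hg rh lh.
have hQ := mixed_gap a g b h l ha hg hb rh lh.
rewrite affinityC in hP; rewrite (affinityC _ _ (trunc g)) in hQ.
rewrite (affinityC _ _ (trunc b)) in hP.
rewrite (affinityC _ _ (trunc g)) in hQ.
have := loss_ge a b g x y z 0 _ _ _ hP hQ.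
rewrite subr_ge0 => /(_ (aff_le1 _ _ _ ha hb hg)).
rewrite -/P -/Q mulr0 add0r.
set U := \sum_(s | _) _; set V := \sum_(s | _) _ => hloss.
(* By the arithmetic-geometric mean inequality this dominates [y * z * (b s * g t)] on the triples
   counted, and it separates into a function of [s] and one of [t]. *)
pose w s t := if P s && Q t then (y ^+ 2 * b s ^+ 2 + z ^+ 2 * g t ^+ 2) / 2 else 0.
have w0 s t : 0 <= w s t.
  by rewrite /w; case: ifP => // _; nonneg.
have hw r : \sum_s w s (c - r - s) <= (y ^+ 2 * U + z ^+ 2 * V) / 2.
  apply: (@le_trans _ _ (\sum_s (if P s then y ^+ 2 * b s ^+ 2 / 2 else 0) +
     \sum_s (if Q (c - r - s) then z ^+ 2 * g (c - r - s) ^+ 2 / 2 else 0))).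
    rewrite -big_split; apply: ler_sum => s _ /=; rewrite /w.
    have e1 : 0 <= y ^+ 2 * b s ^+ 2 by rewrite mulr_ge0 ?sqr_ge0.
    have e2 : 0 <= z ^+ 2 * g (c - r - s) ^+ 2 by rewrite mulr_ge0 ?sqr_ge0.
    by case: (P s); case: (Q _) => /=; lra.
  rewrite (sum_refl _ _ (fun t => if Q t then z ^+ 2 * g t ^+ 2 / 2 else 0)).
  by rewrite mulrDl !mulr_sumr !mulr_suml -!big_mkcond /=.
have hwt r s t : r + s + t = c -> [&& h < a r ^+ 2, b s ^+ 2 <= l & g t ^+ 2 <= l] ->
    y * z * (b s * g t) <= w s t.
  move=> e /and3P[hr hs ht]; rewrite /w.
  have -> : P s.
    apply/existsP; exists r; rewrite hr /=.
    by rewrite -e [_ + t - s]addrAC addrK addrAC subrr add0r.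
  have -> : Q t.
    by apply/existsP; exists r; rewrite hr -e addrK addrAC subrr add0r.
  have := sqr_ge0 (y * b s - z * g t) => /=; nra.
have W0 : 0 <= y ^+ 2 * U + z ^+ 2 * V.
  by nonneg; apply: sumr_ge0 => s _; apply: sqr_ge0.
apply: (@le_trans _ _
  (k * (x ^+ 2 * y ^+ 2 * z ^+ 2 * ((y ^+ 2 * U + z ^+ 2 * V) / 2)))); last first.
  apply: (@le_trans _ _ (4 * k / h * (x ^+ 2 * y ^+ 2 * z ^+ 2 *
     (y ^+ 2 * (h / 8 * U) + z ^+ 2 * (h / 8 * V))))).
    by eqle; field; rewrite gt_eqF.
  by apply: ler_wpM2l => //; nonneg.
have [b0 _] := hb; have [g0 _] := hg; have [a0 a1] := ha.
have [hk|hk] := leP (k * (y * z)) (x ^+ 2).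
  have l0 : 0 <= l \/ l < 0 by case: (leP 0 l); [left|right].
  case: l0 => [l0|l0]; last first.
    rewrite [X in X <= _](_ : _ = 0).
      by nonneg.
    rewrite /tsum big1 // => r _; rewrite big1 // => s _; case: ifP => // /and3P[_ hs _].
    by move: (sqr_ge0 (b s)); lra.
  apply: (@le_trans _ _ (y ^+ 3 * z ^+ 3 * l * (\sum_(r | h < a r ^+ 2)
     1 * ((y ^+ 2 * U + z ^+ 2 * V) / 2)))).
    rewrite mulr_sumr [X in _ <= X]big_mkcond /tsum; apply: ler_sum => r _.
    case: ifP => hr; last by rewrite big1 // => s _; case: ifP => // /andP[].
    rewrite mul1r; apply: le_trans (ler_wpM2l _ (hw r)); last first.
      by nonneg.
    rewrite mulr_sumr; apply: ler_sum => s _; set t := c - r - s.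
    have e : r + s + t = c by rewrite /t addrC -[c - r - s]addrA -opprD subrK.
    case: ifP => [hh|_]; last by nonneg.
    have [_ _ _ ht3] := hc r s t e; apply: (le_trans ht3).
    have hbg : b s * g t <= l.
      have /and3P[_ h2 h3] : [&& h < a r ^+ 2, b s ^+ 2 <= l & g t ^+ 2 <= l].
        by rewrite hr.
      by move: (sqr_ge0 (b s - g t)); nra.
    have := hwt r s t e; rewrite hr => /(_ hh) hws.
    apply: (@le_trans _ _ (y ^+ 3 * z ^+ 3 * l * (y * z * (b s * g t)))).
      have -> : y ^+ 4 * z ^+ 4 * (b s ^+ 2 * g t ^+ 2) =
        y ^+ 3 * z ^+ 3 * (b s * g t) * (y * z * (b s * g t)) by ring.
      by apply: ler_wpM2r; [nonneg|apply: ler_wpM2l => //; nonneg].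
    by apply: ler_wpM2l => //; nonneg.
  rewrite -mulr_suml; have := card_heavy a h ha h0.
  set H := \sum_(r | _) _ => hH.
  set W := (_ / 2); have W0' : 0 <= W by rewrite divr_ge0.
  apply: (@le_trans _ _ (y ^+ 3 * z ^+ 3 * (k ^+ 2 * h) * (h^-1 * W))).
    apply: ler_pM; [by nonneg| |by apply: ler_wpM2l => //; nonneg|
                    by apply: ler_wpM2r].
    by apply: mulr_ge0 => //; apply: sumr_ge0.
  have -> : y ^+ 3 * z ^+ 3 * (k ^+ 2 * h) * (h^-1 * W) =
     (k * y ^+ 2 * z ^+ 2 * W) * (k * (y * z)) by field; rewrite gt_eqF.
  have -> : k * (x ^+ 2 * y ^+ 2 * z ^+ 2 * W) = (k * y ^+ 2 * z ^+ 2 * W) * x ^+ 2.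
    by ring.
  by apply: ler_wpM2l => //; nonneg.
apply: (@le_trans _ _ (\sum_r (a r ^+ 2 * (x ^+ 4 * y * z *
     ((y ^+ 2 * U + z ^+ 2 * V) / 2))))).
  apply: ler_sum => r _.
  apply: le_trans (ler_wpM2l _ (ler_wpM2l _ (hw r))); last first.
  - by nonneg.
  - exact: sqr_ge0.
  rewrite !mulr_sumr; apply: ler_sum => s _; set t := c - r - s.
  have e : r + s + t = c by rewrite /t addrC -[c - r - s]addrA -opprD subrK.
  case: ifP => [hh|_]; last by nonneg.
  apply: (le_trans (cap_geom tau a b g x y z x0 y0 z0 ha hb hg hc r s t e)).
  have -> : x ^+ 4 * y ^+ 2 * z ^+ 2 * (a r ^+ 2 * (b s * g t)) =
    a r ^+ 2 * (x ^+ 4 * y * z * (y * z * (b s * g t))) by ring.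
  by do 2 (apply: ler_wpM2l; first by nonneg); exact: (hwt r s t e hh).
rewrite -mulr_suml a1 mul1r; set W := (_ / 2); have W0' : 0 <= W by rewrite divr_ge0.
have -> : x ^+ 4 * y * z * W = (x ^+ 2 * y * z * W) * x ^+ 2 by ring.
have -> : k * (x ^+ 2 * y ^+ 2 * z ^+ 2 * W) = (x ^+ 2 * y * z * W) * (k * (y * z)).
  by ring.
by apply: ler_wpM2l; [nonneg|exact: ltW].
Qed.

(** One such triple already costs [h ^+ 2 / 8] in two affinities, since its heavy children each
    carry mass above [h]. If [x * y <= k * z ^+ 2], the cap through [a] and [b] is enough; otherwise
    the geometric cap through [g] is summed over at most [h^-1 * h^-1] heavy pairs. *)
Lemma mixed_heavy_heavy_light tau a b g x y z h l k :
  0 < x -> 0 < y -> 0 < z -> unitv a -> unitv b -> unitv g ->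
  capped tau a b g x y z -> rho <= h -> l <= h / 4 -> 0 <= k ->
  l <= k ^+ 2 * h ^+ 2 ->
  tsum F R c (fun r s t =>
    if [&& h < a r ^+ 2, h < b s ^+ 2 & g t ^+ 2 <= l] then tau r s t else 0)
  <= 4 * k / h ^+ 2 * loss a b g x y z.
Proof.
move=> x0 y0 z0 ha hb hg hc rh lh k0 lk.
have h0 : 0 < h by apply: lt_le_trans rh.
have [b0 b1] := hb; have [g0 g1] := hg; have [a0 a1] := ha.
have L0 := loss_ge0 a b g x y z ha hb hg.
have K0 : 0 <= 4 * k / h ^+ 2 by nonneg.
case: (boolP [exists r, exists s,
    [&& h < a r ^+ 2, h < b s ^+ 2 & g (c - r - s) ^+ 2 <= l]]); last first.
  rewrite negb_exists => /forallP hno; rewrite /tsum big1; first by nonneg.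
  move=> r _; rewrite big1 // => s _; move: (hno r).
  by rewrite negb_exists => /forallP /(_ s) /negbTE ->.
case/existsP => r0 /existsP [s0 /and3P[hr0 hs0 ht0]].
have gap1 : h ^+ 2 / 8 <= 1 - aff a b g.
  apply: le_trans (mixed_gap b a g h l hb ha hg rh lh).
  rewrite (bigD1 r0) /=; last by apply/existsP; exists s0; rewrite hs0.
  have : 0 <= \sum_(i | [exists r, (h < b r ^+ 2) && (g (c - i - r) ^+ 2 <= l)]
    && (i != r0)) a i ^+ 2 by apply: sumr_ge0 => i _; apply: sqr_ge0.
  set S := \sum_(i | _) _ => S0; nra.
have gap2 : h ^+ 2 / 8 <= 1 - aff b a g.
  apply: le_trans (mixed_gap a b g h l ha hb hg rh lh).
  rewrite (bigD1 s0) /=; last first.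
    by apply/existsP; exists r0; rewrite hr0 addrAC.
  have : 0 <= \sum_(i | [exists r, (h < a r ^+ 2) && (g (c - i - r) ^+ 2 <= l)]
    && (i != s0)) b i ^+ 2 by apply: sumr_ge0 => i _; apply: sqr_ge0.
  set S := \sum_(i | _) _ => S0; nra.
have gap3 : 0 <= 1 - aff g a b by rewrite subr_ge0 aff_le1.
apply: (@le_trans _ _ (k * (x ^+ 3 * y ^+ 3 * z ^+ 2))); last first.
  apply: le_trans (ler_wpM2l K0 (loss_ge a b g x y z _ _ _ gap1 gap2 gap3)).
  have -> : 4 * k / h ^+ 2 * (x ^+ 2 * y ^+ 2 * z ^+ 2 *
     (x ^+ 2 * (h ^+ 2 / 8) + y ^+ 2 * (h ^+ 2 / 8) + z ^+ 2 * 0)) =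
     k * (x ^+ 2 * y ^+ 2 * z ^+ 2) * ((x ^+ 2 + y ^+ 2) / 2).
    by field; rewrite gt_eqF.
  have -> : k * (x ^+ 3 * y ^+ 3 * z ^+ 2) =
     k * (x ^+ 2 * y ^+ 2 * z ^+ 2) * (x * y) by ring.
  apply: ler_wpM2l; first by nonneg.
  by have := sqr_ge0 (x - y); lra.
have [hk|hk] := leP (x * y) (k * z ^+ 2).
  apply: (@le_trans _ _ (\sum_r (a r ^+ 2 * (x ^+ 4 * y ^+ 4)))).
    apply: ler_sum => r _.
    rewrite -[X in _ <= a r ^+ 2 * X]mulr1 -b1 !mulr_sumr; apply: ler_sum => s _.
    set t := c - r - s.
    have e : r + s + t = c by rewrite /t addrC -[c - r - s]addrA -opprD subrK.
    case: ifP => _; last by nonneg.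
    have [_ ht _ _] := hc r s t e; apply: (le_trans ht); eqle; ring.
  rewrite -mulr_suml a1 mul1r.
  have -> : k * (x ^+ 3 * y ^+ 3 * z ^+ 2) = (x ^+ 3 * y ^+ 3) * (k * z ^+ 2).
    by ring.
  have -> : x ^+ 4 * y ^+ 4 = (x ^+ 3 * y ^+ 3) * (x * y) by ring.
  by apply: ler_wpM2l => //; nonneg.
have l0 : 0 <= l by apply: le_trans ht0; apply: sqr_ge0.
apply: (@le_trans _ _ (\sum_(r | h < a r ^+ 2) \sum_(s | h < b s ^+ 2)
    (z ^+ 4 * x ^+ 2 * y ^+ 2 * l))).
  rewrite [X in _ <= X]big_mkcond; apply: ler_sum => r _.
  case: ifP => hr; last by rewrite big1.
  rewrite [X in _ <= X]big_mkcond; apply: ler_sum => s _.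
  case: (boolP (h < b s ^+ 2)) => hs //=.
  set t := c - r - s.
  have e : t + r + s = c by rewrite -addrA /t -[c - r - s]addrA -opprD subrK.
  case: ifP => [ht|_]; last by nonneg.
  have := cap_geom _ g a b z x y z0 x0 y0 hg ha hb
   (capped_swap12 _ _ _ _ _ _ _ (capped_swap23 _ _ _ _ _ _ _ hc)) t r s e.
  move=> /le_trans; apply; apply: ler_wpM2l; first by nonneg.
  rewrite -[X in _ <= X]mulr1; apply: ler_pM => //; [nonneg|nonneg|].
  have := unitv_le1 a r ha; have := unitv_le1 b s hb.
  have := sqr_ge0 (a r - b s); lra.
under eq_bigr do rewrite sumr_const -[_ *+ _]mulr_natr.
have card1 (v : F -> R) : \sum_(r | h < v r ^+ 2) 1 = #|[pred r | h < v r ^+ 2]|%:R :> R.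
  by rewrite sumr_const.
rewrite sumr_const -[_ *+ _]mulr_natr -!card1.
have := card_heavy a h ha h0; have := card_heavy b h hb h0.
set H1 := \sum_(r | _) 1; set H2 := \sum_(r | _) 1 => hH1 hH2.
have H10 : 0 <= H1 by apply: sumr_ge0.
have H20 : 0 <= H2 by apply: sumr_ge0.
apply: (@le_trans _ _ (z ^+ 4 * x ^+ 2 * y ^+ 2 * (k ^+ 2 * h ^+ 2) * h^-1 * h^-1)).
  apply: ler_pM => //; first by nonneg.
  apply: ler_pM => //; first by nonneg.
  by apply: ler_wpM2l => //; nonneg.
have -> : z ^+ 4 * x ^+ 2 * y ^+ 2 * (k ^+ 2 * h ^+ 2) / h / h =
   (k * x ^+ 2 * y ^+ 2 * z ^+ 2) * (k * z ^+ 2) by field; rewrite gt_eqF.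
have -> : k * (x ^+ 3 * y ^+ 3 * z ^+ 2) = (k * x ^+ 2 * y ^+ 2 * z ^+ 2) * (x * y).
  by ring.
by apply: ler_wpM2l; [nonneg|exact: ltW].
Qed.

Lemma main_gap b g r s t : unitv b -> unitv g ->
  9/10 <= b s ^+ 2 -> 9/10 <= g t ^+ 2 -> t != c - r - s ->
  deg F R (trunc b) (trunc g) c r <= 1 - 18/100.
Proof.
move=> hb hg hs ht ne.
apply: (le_trans (deg_le _ _ _ _ c r s (trunc_subunit _ hb) (trunc_subunit _ hg))).
have hrho : rho < b s ^+ 2.
  apply: lt_le_trans hs.
  by apply: le_lt_trans rho1 _; lra.
have -> : trunc b s = b s by rewrite /trunc hrho.
have := trunc_sqr_le g (c - r - s); have := trunc_ge0 g (c - r - s) hg.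
set v := trunc g _ => v0 v1.
have : g (c - r - s) ^+ 2 <= 1 / 10.
  have := unitv_off g t hg; rewrite (bigD1 (c - r - s)) 1?eq_sym //=.
  have : 0 <= \sum_(i | (i != t) && (i != c - r - s)) g i ^+ 2.
    by apply: sumr_ge0 => i _; apply: sqr_ge0.
  by set S := \sum_(i | _) _; lra.
move=> hv; have b0 := proj1 hb s.
(* The main child of [b] meets a minor child of [g]: the roots differ by at least 62/100, and half
   the square of that exceeds 18/100. *)
have hv2 : v <= 32/100 by rewrite -ler_sqr ?nnegrE //; lra.
have hb2 : 94/100 <= b s by rewrite -ler_sqr ?nnegrE //; lra.
nra.
Qed.

(** Any residue other than [r] pairs the main child [s] with a minor child of [g], so by [main_gap]
    all mass of [a] outside [r] loses degree. *)
Lemma near_gap a b g r s t : unitv a -> unitv b -> unitv g ->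
  9/10 <= b s ^+ 2 -> 9/10 <= g t ^+ 2 -> r + s + t = c ->
  (1 - a r ^+ 2) / 10 <= 1 - aff a b g.
Proof.
move=> ha hb hg hs ht e.
have gap := affinity_gap a b g (fun r' => if r' == r then 0 else 18/100) ha hb hg.
apply: le_trans (gap _) => [|r'].
  rewrite (bigD1 r) //= eqxx mulr0 add0r -(unitv_off a r ha) mulr_suml.
  apply: ler_sum => r' /negbTE ->; have := sqr_ge0 (a r'); lra.
case: eqP => [_|ne]; first by rewrite subr0 deg_le1 //; apply: trunc_subunit.
apply: (main_gap b g r' s t) => //; apply/eqP => et; apply: ne.
apply: (addIr s); apply: (addIr t); rewrite e.
by rewrite et addrC -[c - r' - s]addrA -opprD subrK.
Qed.

Lemma off_gap a b g r s t : unitv a -> unitv b -> unitv g ->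
  9/10 <= a r ^+ 2 -> 9/10 <= b s ^+ 2 -> 9/10 <= g t ^+ 2 -> r + s + t != c ->
  1/1000 <= 1 - aff a b g.
Proof.
move=> ha hb hg hr hs ht ne.
have gap := affinity_gap a b g (fun r' => if r' == r then 18/100 else 0) ha hb hg.
apply: le_trans (gap _) => [|r'].
  rewrite (bigD1 r) //= eqxx big1 ?addr0; first lra.
  by move=> r' /negbTE ->; rewrite mulr0.
case: eqP => [->|_]; last by rewrite subr0 deg_le1 //; apply: trunc_subunit.
apply: (main_gap b g r s t) => //; apply: contraNneq ne => ->.
by rewrite addrC -[c - r - s]addrA -opprD subrK.
Qed.

(** If [x * y <= z ^+ 2], the cap through [a] and [b] yields the product of the two off-masses;
    otherwise the geometric cap through [g] is used and the arithmetic-geometric mean inequality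
    separates [r] from [s]. *)
Lemma off_pair tau a b g x y z r0 s0 :
  0 < x -> 0 < y -> 0 < z -> unitv a -> unitv b -> unitv g ->
  capped tau a b g x y z ->
  tsum F R c (fun r s t => if (r != r0) && (s != s0) then tau r s t else 0) <=
  x ^+ 2 * y ^+ 2 * z ^+ 2 *
    (x ^+ 2 * (1 - a r0 ^+ 2) + y ^+ 2 * (1 - b s0 ^+ 2)).
Proof.
move=> x0 y0 z0 ha hb hg hc.
have [b0 b1] := hb; have [g0 g1] := hg; have [a0 a1] := ha.
have ua := unitv_off a r0 ha; have ub := unitv_off b s0 hb.
have ua0 : 0 <= 1 - a r0 ^+ 2 by rewrite subr_ge0 unitv_le1.
have ub0 : 0 <= 1 - b s0 ^+ 2 by rewrite subr_ge0 unitv_le1.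
set u := 1 - a r0 ^+ 2 in ua ua0 *; set v := 1 - b s0 ^+ 2 in ub ub0 *.
have u1 : u <= 1 by rewrite /u lerBlDr lerDl sqr_ge0.
have v1 : v <= 1 by rewrite /v lerBlDr lerDl sqr_ge0.
have [hk|hk] := leP (x * y) (z ^+ 2).
  apply: (@le_trans _ _ (x ^+ 4 * y ^+ 4 * (u * v))).
    rewrite -ua -ub mulrA [X in _ <= X * _]mulr_sumr mulr_suml.
    rewrite [X in _ <= X]big_mkcond; apply: ler_sum => r _.
    case: ifP => hr; last by rewrite big1.
    rewrite mulr_sumr [X in _ <= X]big_mkcond; apply: ler_sum => s _.
    case: (boolP (s != s0)) => hs //=; set t := c - r - s.
    have e : r + s + t = c by rewrite /t addrC -[c - r - s]addrA -opprD subrK.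
    have [_ ht _ _] := hc r s t e; apply: (le_trans ht); eqle; ring.
  have -> : x ^+ 4 * y ^+ 4 * (u * v) = x ^+ 2 * y ^+ 2 * ((x * y) * (x * y * (u * v))).
    by ring.
  rewrite -[X in _ <= X]mulrA; apply: ler_wpM2l; first by nonneg.
  apply: ler_pM => //; [nonneg|nonneg|].
  have w0 : 0 <= u * v by nonneg.
  have wu : u * v <= u by rewrite ler_piMr.
  have wv : u * v <= v by rewrite ler_piMl.
  have := sqr_ge0 (x - y); have := sqr_ge0 x; have := sqr_ge0 y; nra.
have hc' := capped_swap12 _ _ _ _ _ _ _ (capped_swap23 _ _ _ _ _ _ _ hc).
apply: (@le_trans _ _ (\sum_t (g t ^+ 2 * (z ^+ 4 * x * y *
   ((x ^+ 2 * u + y ^+ 2 * v) / 2))))).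
  rewrite tsum_swap23 tsum_swap12; apply: ler_sum => t _.
  apply: (@le_trans _ _ (g t ^+ 2 * (z ^+ 4 * x * y *
    \sum_r ((if r != r0 then x ^+ 2 * a r ^+ 2 / 2 else 0) +
     (if c - t - r != s0 then y ^+ 2 * b (c - t - r) ^+ 2 / 2 else 0))))).
    rewrite !mulr_sumr; apply: ler_sum => r _; set s := c - t - r.
    have e : t + r + s = c by rewrite /s addrC -[c - t - r]addrA -opprD subrK.
    have ht := cap_geom _ g a b z x y z0 x0 y0 hg ha hb hc' t r s e.
    case: (r != r0); case: (s != s0) => /=; try by nonneg.
    apply: (le_trans ht); apply: (@le_trans _ _
      (g t ^+ 2 * (z ^+ 4 * x * y * ((x * a r) * (y * b s))))).
      by eqle; ring.
    do 2 (apply: ler_wpM2l; first by nonneg).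
    by have := sqr_ge0 (x * a r - y * b s); lra.
  apply: ler_wpM2l; first exact: sqr_ge0.
  apply: ler_wpM2l; first by nonneg.
  rewrite big_split /= (sum_refl _ _ (fun s => if s != s0 then y ^+ 2 * b s ^+ 2 / 2 else 0)).
  by rewrite -!big_mkcond /= -!mulr_suml -!mulr_sumr ua ub mulrDl.
rewrite -mulr_suml g1 mul1r.
set W := x ^+ 2 * u + _; have W0 : 0 <= W by rewrite /W; nonneg.
have -> : z ^+ 4 * x * y * (W / 2) = (z ^+ 2 * x * y * W / 2) * z ^+ 2 by ring.
apply: (@le_trans _ _ ((z ^+ 2 * x * y * W / 2) * (x * y))).
  by apply: ler_wpM2l; [nonneg|exact: ltW].
have -> : z ^+ 2 * x * y * W / 2 * (x * y) = x ^+ 2 * y ^+ 2 * z ^+ 2 * W / 2 by ring.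
by rewrite ler_pdivrMr // ler_peMr //; [nonneg|lra].
Qed.

(** * Splittings with small loss have one main child in each set *)

Hypothesis rect_all : forall X : {set F}, #|X|%:R <= 3 / rho ->
  exists f, rectified F X f.

Lemma gap_tsum tau a b g x y z : 0 < x -> 0 < y -> 0 < z ->
  unitv a -> unitv b -> unitv g -> capped tau a b g x y z ->
  1 / 1000 <= 1 - aff a b g -> tsum F R c tau <= 1000 * loss a b g x y z.
Proof.
move=> x0 y0 z0 ha hb hg hc gap.
apply: (le_trans (tsum_cap tau a b g x y z x0 y0 z0 ha hb hg hc)).
have g2 : 0 <= 1 - aff b a g by rewrite subr_ge0 aff_le1.
have g3 : 0 <= 1 - aff g a b by rewrite subr_ge0 aff_le1.
have := loss_ge a b g x y z _ _ _ gap g2 g3; lra.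
Qed.

(** An affinity gap of 1/1000 pays for all solutions. Without one, the truncated supports, at most
    3/rho residues together, are rectified and [concentrated] gives main children; if these do not
    sum to [c], [off_gap] leads back to the first case. *)
Lemma local_dichotomy tau a b g x y z : 0 < x -> 0 < y -> 0 < z ->
  unitv a -> unitv b -> unitv g -> capped tau a b g x y z ->
  let L := loss a b g x y z in
  tsum F R c tau <= 1000 * L \/
  exists r0 s0 t0, [/\ r0 + s0 + t0 = c,
    [/\ 9/10 <= a r0 ^+ 2, 9/10 <= b s0 ^+ 2 & 9/10 <= g t0 ^+ 2],
    x ^+ 4 * y ^+ 2 * z ^+ 2 * (1 - a r0 ^+ 2) <= 10 * L &
    tsum F R c (fun r s t =>
      if [&& r == r0, s == s0 & t == t0] then 0 else tau r s t) <= 30 * L].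
Proof.
move=> x0 y0 z0 ha hb hg hc L.
have [g1|g1] := leP (1/1000) (1 - aff a b g).
  by left; apply: gap_tsum.
have hc12 := capped_swap12 _ _ _ _ _ _ _ hc.
have hc23 := capped_swap23 _ _ _ _ _ _ _ hc.
have [g2|g2] := leP (1/1000) (1 - aff b a g).
  left; rewrite tsum_swap12 /L loss_swap12; exact: gap_tsum.
have [g3|g3] := leP (1/1000) (1 - aff g a b).
  left; rewrite tsum_swap23 tsum_swap12 /L loss_swap23 loss_swap12.
  by apply: gap_tsum => //; apply: capped_swap12.
pose H v := [set r | rho < v r ^+ 2] : {set F}.
pose X := (H a :|: H b :|: H g)%SET.
have cardH v : unitv v -> #|H v|%:R <= rho^-1 :> R.
  move=> hv; apply: le_trans (card_heavy v rho hv rho0).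
  by rewrite sumr_const /H cardsE.
have cardX : #|X|%:R <= 3 / rho :> R.
  apply: (@le_trans _ _ (#|H a| + #|H b| + #|H g|)%N%:R).
    rewrite ler_nat; apply: leq_trans (leq_card_setU _ _) _.
    by rewrite leq_add2r; apply: leq_card_setU.
  rewrite !natrD; move: (cardH a ha) (cardH b hb) (cardH g hg); lra.
have [f hf] := rect_all X cardX.
have supp v r : 0 < trunc v r -> r \in H v.
  by rewrite inE /trunc; case: ifP => //; rewrite ltxx.
have [||| |||[r0 hr] [s0 hs] [t0 ht]] := concentrated F R (trunc a) (trunc b) (trunc g) c X f
  (trunc_subunit _ ha) (trunc_subunit _ hb) (trunc_subunit _ hg) hf.
- by move=> r /supp; rewrite !inE => ->.
- by move=> r /supp; rewrite !inE => ->; rewrite orbT.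
- by move=> r /supp; rewrite !inE => ->; rewrite orbT.
- by lra.
- by lra.
- by lra.
move: hr hs ht => /le_trans/(_ (trunc_sqr_le _ _)) hr.
move=> /le_trans/(_ (trunc_sqr_le _ _)) hs /le_trans/(_ (trunc_sqr_le _ _)) ht.
have [e|ne] := eqVneq (r0 + s0 + t0) c; last first.
  left; apply: gap_tsum => //.
  exact: (off_gap a b g r0 s0 t0).
right; exists r0, s0, t0.
have n1 := near_gap a b g r0 s0 t0 ha hb hg hs ht e.
have n2 : (1 - b s0 ^+ 2) / 10 <= 1 - aff b a g.
  by apply: (near_gap b a g s0 r0 t0) => //; rewrite [s0 + _]addrC.
have n3 : (1 - g t0 ^+ 2) / 10 <= 1 - aff g a b.
  by apply: (near_gap g a b t0 r0 s0) => //; rewrite -addrA addrC.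
have := loss_ge a b g x y z _ _ _ n1 n2 n3; rewrite -/L.
have u1 : 0 <= 1 - a r0 ^+ 2 by rewrite subr_ge0 unitv_le1.
have u2 : 0 <= 1 - b s0 ^+ 2 by rewrite subr_ge0 unitv_le1.
have u3 : 0 <= 1 - g t0 ^+ 2 by rewrite subr_ge0 unitv_le1.
set u := 1 - a r0 ^+ 2 in u1 *; set v := 1 - b s0 ^+ 2 in u2 *.
set w := 1 - g t0 ^+ 2 in u3 *.
set K := x ^+ 2 * y ^+ 2 * z ^+ 2 => hL.
have K0 : 0 <= K by rewrite /K; nonneg.
have xu : 0 <= K * (x ^+ 2 * u) by nonneg.
have yv : 0 <= K * (y ^+ 2 * v) by nonneg.
have zw : 0 <= K * (z ^+ 2 * w) by nonneg.
have hL' : K * (x ^+ 2 * u) + K * (y ^+ 2 * v) + K * (z ^+ 2 * w) <= 10 * L by lra.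
split=> //.
  have -> : x ^+ 4 * y ^+ 2 * z ^+ 2 * u = K * (x ^+ 2 * u) by rewrite /K; ring.
  lra.
have o1 := off_pair tau a b g x y z r0 s0 x0 y0 z0 ha hb hg hc.
have o2 := off_pair _ a g b x z y r0 t0 x0 z0 y0 ha hg hb hc23.
have o3 := off_pair _ b g a y z x s0 t0 y0 z0 x0 hb hg ha
  (capped_swap23 _ _ _ _ _ _ _ hc12).
rewrite tsum_swap23 in o2; rewrite tsum_swap23 tsum_swap12 in o3.

(* Two residues of a solution fix the third, so a triple other than the main one differs from it in
   at least two places. Each of the three pairs of places costs at most 10 L by [off_pair]. *)
apply: (@le_trans _ _ (
  tsum F R c (fun r s t => if (r != r0) && (s != s0) then tau r s t else 0) +
  tsum F R c (fun r s t => if (r != r0) && (t != t0) then tau r s t else 0) +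
  tsum F R c (fun r s t => if (s != s0) && (t != t0) then tau r s t else 0))).
  rewrite -!tsumD; apply: ler_tsum => r s t ec; have [t1 _ _ _] := hc r s t ec.
  have h12 : r == r0 -> s == s0 -> t == t0.
    by move=> /eqP er /eqP es; apply/eqP/(addrI (r0 + s0)); rewrite e -ec er es.
  have h13 : r == r0 -> t == t0 -> s == s0.
    move=> /eqP er /eqP et; apply/eqP/(addrI r0)/(addIr t0).
    by rewrite e -ec er et.
  have h23 : s == s0 -> t == t0 -> r == r0.
    move=> /eqP es /eqP et; apply/eqP/(addIr s0)/(addIr t0).
    by rewrite e -ec es et.
  move: h12 h13 h23 t1; clear.
  case: (r == r0); case: (s == s0); case: (t == t0) => /= h1 h2 h3 t1;
    rewrite ?addr0 ?add0r ?lerDl ?addr_ge0 //.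
  - by move: (h1 isT isT).
  - by move: (h2 isT isT).
  - by move: (h3 isT isT).
  - by rewrite -addrA lerDl addr_ge0.
have -> : 30 * L = 10 * L + 10 * L + 10 * L by lra.
apply: lerD; first apply: lerD.
- apply: (le_trans o1); rewrite -/K -/u -/v; lra.
- apply: (le_trans o2); rewrite -/u -/w.
  have -> : x ^+ 2 * z ^+ 2 * y ^+ 2 * (x ^+ 2 * u + z ^+ 2 * w) =
    K * (x ^+ 2 * u) + K * (z ^+ 2 * w) by rewrite /K; ring.
  lra.
- apply: (le_trans o3); rewrite -/v -/w.
  have -> : y ^+ 2 * z ^+ 2 * x ^+ 2 * (y ^+ 2 * v + z ^+ 2 * w) =
    K * (y ^+ 2 * v) + K * (z ^+ 2 * w) by rewrite /K; ring.
  lra.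
Qed.

(** For [unsettled_bound]: the proportion of the set that a solution leaves behind at a splitting is
    paid for by the loss of potential. *)
Lemma tsum_drop tau a b g x y z : 0 < x -> 0 < y -> 0 < z ->
  unitv a -> unitv b -> unitv g -> capped tau a b g x y z ->
  tsum F R c (fun r s t => tau r s t * (1 - a r ^+ 2)) <=
  1000 * loss a b g x y z.
Proof.
move=> x0 y0 z0 ha hb hg hc; set L := loss _ _ _ _ _ _.
have L0 : 0 <= L by apply: loss_ge0.
case: (local_dichotomy tau a b g x y z x0 y0 z0 ha hb hg hc) => [h|].
  apply: le_trans h; apply: ler_tsum => r s t e; have [t0 _ _ _] := hc r s t e.
  by rewrite ler_piMr // lerBlDr lerDl sqr_ge0.
case=> r0 [s0 [t0 [e0 _ hx hn]]].
have u0 : 0 <= 1 - a r0 ^+ 2 by rewrite subr_ge0 unitv_le1.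
apply: (@le_trans _ _ (
  tsum F R c (fun r s t =>
      if [&& r == r0, s == s0 & t == t0] then 0 else tau r s t) +
  tsum F R c (fun r s t =>
      if (r == r0) && (s == s0) then 10 * L else 0))); last first.
  rewrite {2}/tsum (bigD1 r0) //= (bigD1 s0) //= !eqxx big1 => [|s /negbTE ->].
    rewrite big1 ?addr0 => [|r /negbTE -> /=]; last by rewrite big1.
    apply: le_trans (lerD hn (lexx _)) _; rewrite -/L; lra.
  by rewrite andbF.
rewrite -tsumD; apply: ler_tsum => r s t e; have [tr0 _ _ _] := hc r s t e.
have ar1 : tau r s t * (1 - a r ^+ 2) <= tau r s t.
  by rewrite ler_piMr // lerBlDr lerDl sqr_ge0.
case: (eqVneq r r0) => [er|_] /=; last by rewrite addr0.
case: (eqVneq s s0) => [es|_] /=; last by rewrite addr0.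
have -> : t = t0 by apply: (addrI (r0 + s0)); rewrite e0 -e er es.
rewrite eqxx add0r; apply: le_trans hx; rewrite er; apply: ler_wpM2r => //.
have ec : r0 + s + t0 = c by rewrite es.
apply: le_trans (cap_geom tau a b g x y z x0 y0 z0 ha hb hg hc _ _ _ ec) _.
have [a0 _] := ha; have [b0 _] := hb; have [g0 _] := hg.
rewrite -[X in _ <= X]mulr1; apply: ler_wpM2l; first by nonneg.
rewrite -[1]mulr1; apply: ler_pM; [nonneg|nonneg|exact: unitv_le1|].
have := unitv_le1 b s hb; have := unitv_le1 g t0 hg.
have := sqr_ge0 (b s - g t0); lra.
Qed.

Lemma tsum_small tau a b g x y z : 0 < x -> 0 < y -> 0 < z ->
  unitv a -> unitv b -> unitv g -> capped tau a b g x y z ->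
  tsum F R c (fun r s t => tau r s t *+
    [|| a r ^+ 2 <= 1/2, b s ^+ 2 <= 1/2 | g t ^+ 2 <= 1/2]) <=
  1000 * loss a b g x y z.
Proof.
move=> x0 y0 z0 ha hb hg hc; set L := loss _ _ _ _ _ _.
have L0 : 0 <= L by apply: loss_ge0.
case: (local_dichotomy tau a b g x y z x0 y0 z0 ha hb hg hc) => [h|].
  apply: le_trans h; apply: ler_tsum => r s t e; have [t0 _ _ _] := hc r s t e.
  by rewrite mulrb; case: ifP.
case=> r0 [s0 [t0 [e0 [ar bs gt] _ hn]]].
apply: (@le_trans _ _ (30 * L)); last by rewrite ler_wpM2r // ler_nat.
apply: le_trans hn; apply: ler_tsum => r s t e; have [tr0 _ _ _] := hc r s t e.
have big (v : R) : 9/10 <= v -> (v <= 1/2) = false.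
  by move=> hv; apply: lt_geF; apply: lt_le_trans hv; lra.
case: ifP => [/and3P[/eqP -> /eqP -> /eqP ->]|_].
  by rewrite !big.
by rewrite mulrb; case: ifP.
Qed.

(** * Splittings seen at a decreasing sequence of thresholds *)

(* A child triple splits at h when h separates its three relative sizes; it
   is then mixed (no relative size in (l, h]) or ambiguous. *)
Definition splits (h : R) (u v w : R) : bool :=
  ~~ [&& h < u, h < v & h < w] && [|| h < u, h < v | h < w].

Definition window (h l : R) (u : R) : bool := (l < u) && (u <= h).

Lemma cut_cases h l u v w : (splits h u v w <=
  window h l u + window h l v + window h l w +
  ([&& (h < u)%R, (v <= l)%R & (w <= l)%R] + [&& (h < v)%R, (u <= l)%R & (w <= l)%R] +
   [&& (h < w)%R, (u <= l)%R & (v <= l)%R]) +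
  ([&& (h < u)%R, (h < v)%R & (w <= l)%R] + [&& (h < u)%R, (h < w)%R & (v <= l)%R] +
   [&& (h < v)%R, (h < w)%R & (u <= l)%R]))%N.
Proof.
rewrite /splits /window ![_ <= h]leNgt ![l < _]ltNge.
case: (h < u); case: (h < v); case: (h < w); case: (u <= l); case: (v <= l);
  by case: (w <= l).
Qed.

(** Three heavy-light-light and three heavy-heavy-light patterns contribute at most 4 d L each,
    which gives 24; the ambiguous triples stay on the right as windows. *)
Lemma tsum_cut tau a b g x y z h l d : 0 < x -> 0 < y -> 0 < z ->
  unitv a -> unitv b -> unitv g -> capped tau a b g x y z ->
  rho <= h -> h <= 1/2 -> 0 <= d -> d <= 1 -> l = d ^+ 2 * h ^+ 6 ->
  tsum F R c (fun r s t => tau r s t *+ splits h (a r ^+ 2) (b s ^+ 2) (g t ^+ 2))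
  <= tsum F R c (fun r s t => tau r s t *+
      (window h l (a r ^+ 2) + window h l (b s ^+ 2) + window h l (g t ^+ 2)))
     + 24 * d * loss a b g x y z.
Proof.
move=> x0 y0 z0 ha hb hg hc rh h12 d0 d1 el; set L := loss _ _ _ _ _ _.
have L0 : 0 <= L by apply: loss_ge0.
have h0 : 0 < h by apply: lt_le_trans rh.
have hc12 := capped_swap12 _ _ _ _ _ _ _ hc.
have hc23 := capped_swap23 _ _ _ _ _ _ _ hc.
have hc312 := capped_swap12 _ _ _ _ _ _ _ hc23.
have hc231 := capped_swap23 _ _ _ _ _ _ _ hc12.
have h1 n : h ^+ n <= 1 by apply: exprn_ile1; [exact: ltW|lra].
have dd : d ^+ 2 <= 1 by apply: exprn_ile1.
(* With this choice [l = k ^+ 2 * h ^+ 2], and both [4 * k / h] and [4 * k / h ^+ 2] are at most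
   [4 * d]. *)
pose k := d * h ^+ 2.
have k0 : 0 <= k by rewrite /k; nonneg.
have lh : l <= h / 4.
  rewrite el; apply: (@le_trans _ _ (1 * (h ^+ 3 * h))).
    rewrite (_ : h ^+ 6 = h ^+ 3 * h * h ^+ 2); last by ring.
    apply: ler_pM => //; [nonneg|nonneg|]; rewrite ler_piMr //; nonneg.
  rewrite mul1r mulrC; apply: ler_wpM2l; first exact: ltW.
  apply: (@le_trans _ _ ((1/2) ^+ 3)); last lra.
  by rewrite lerXn2r ?nnegrE //; lra.
have lk1 : l <= k ^+ 2 * h.
  have -> : k ^+ 2 * h = d ^+ 2 * (h ^+ 5) by rewrite /k; ring.
  rewrite el; apply: ler_wpM2l; first exact: sqr_ge0.
  by rewrite (_ : h ^+ 6 = h ^+ 5 * h); [rewrite ler_piMr; [|nonneg|lra]|ring].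
have lk2 : l <= k ^+ 2 * h ^+ 2 by rewrite el /k; eqle; ring.
have b1 : 4 * k / h * L <= 4 * d * L.
  apply: ler_wpM2r => //; have -> : 4 * k / h = 4 * d * h.
    by rewrite /k; field; rewrite gt_eqF.
  by rewrite ler_piMr //; [nonneg|lra].
have b2 : 4 * k / h ^+ 2 * L <= 4 * d * L.
  by apply: ler_wpM2r => //; rewrite /k; eqle; field; rewrite gt_eqF.
have L12 : loss b a g y x z = L by rewrite /L loss_swap12.
have L23 : loss a g b x z y = L by rewrite /L -loss_swap23.
have L312 : loss g a b z x y = L by rewrite -loss_swap12.
have L231 : loss b g a y z x = L by rewrite -loss_swap23.
have m1 := mixed_heavy_light_light tau a b g x y z h l k
  x0 y0 z0 ha hb hg hc rh lh k0 lk1.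
have m2 := mixed_heavy_light_light _ b a g y x z h l k
  y0 x0 z0 hb ha hg hc12 rh lh k0 lk1.
have m3 := mixed_heavy_light_light _ g a b z x y h l k
  z0 x0 y0 hg ha hb hc312 rh lh k0 lk1.
have m4 := mixed_heavy_heavy_light tau a b g x y z h l k
  x0 y0 z0 ha hb hg hc rh lh k0 lk2.
have m5 := mixed_heavy_heavy_light _ a g b x z y h l k
  x0 z0 y0 ha hg hb hc23 rh lh k0 lk2.
have m6 := mixed_heavy_heavy_light _ b g a y z x h l k
  y0 z0 x0 hb hg ha hc231 rh lh k0 lk2.
rewrite tsum_swap12 L12 in m2.
rewrite tsum_swap12 tsum_swap23 L312 in m3.
rewrite tsum_swap23 L23 in m5.
rewrite tsum_swap23 tsum_swap12 L231 in m6.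
move: m1 m2 m3 m4 m5 m6; rewrite -/L.
move=> /le_trans/(_ b1) m1 /le_trans/(_ b1) m2 /le_trans/(_ b1) m3.
move=> /le_trans/(_ b2) m4 /le_trans/(_ b2) m5 /le_trans/(_ b2) m6.
have -> : 24 * d * L = (4 * d * L + 4 * d * L + 4 * d * L) +
  (4 * d * L + 4 * d * L + 4 * d * L) by ring.
apply: le_trans (lerD (lexx _) (lerD (lerD (lerD m1 m2) m3) (lerD (lerD m4 m5) m6))).
rewrite -!tsumD; apply: ler_tsum => r s t e; have [tr0 _ _ _] := hc r s t e.
rewrite -!mulrb -!mulrnDr; apply: ler_wpMn2l => //.
by rewrite addnA; exact: cut_cases.
Qed.

Lemma sum_windows (theta : nat -> R) n u :
  (forall j, (j < n)%N -> theta j.+1 <= theta j) ->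
  (\sum_(j < n) window (theta j) (theta j.+1) u <= (u <= theta 0%N)%R)%N.
Proof.
move=> mono.
suff : (\sum_(j < n) window (theta j) (theta j.+1) u + (u <= theta n)%R =
  (u <= theta 0%N)%R)%N by lia.
elim: n mono => [|n IH] mono; first by rewrite big_ord0.
rewrite big_ord_recr /= -IH; last by move=> j jn; apply: mono; apply: ltnW.
rewrite -addnA; congr (_ + _)%N.
have := mono n (ltnSn n); rewrite /window ltNge => h.
case: (leP u (theta n.+1)) => h1; first by rewrite (le_trans h1 h).
by case: (u <= theta n).
Qed.

(** The windows of successive thresholds are disjoint and lie below 1/2. Over all [j] each of the
    three relative sizes is thus ambiguous at most once, and only in triples covered by
    [tsum_small]: hence 3 * 1000, whatever [n] is. *)
Lemma sum_tsum_cut tau a b g x y z (theta : nat -> R) n d :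
  0 < x -> 0 < y -> 0 < z ->
  unitv a -> unitv b -> unitv g -> capped tau a b g x y z ->
  0 <= d -> d <= 1 -> theta 0%N <= 1/2 ->
  (forall j, (j < n)%N -> rho <= theta j) ->
  (forall j, (j < n)%N -> theta j <= 1/2) ->
  (forall j, (j < n)%N -> theta j.+1 = d ^+ 2 * theta j ^+ 6) ->
  \sum_(j < n) tsum F R c (fun r s t => tau r s t *+
     splits (theta j) (a r ^+ 2) (b s ^+ 2) (g t ^+ 2))
  <= (3000 + 24 * d * n%:R) * loss a b g x y z.
Proof.
move=> x0 y0 z0 ha hb hg hc d0 d1 th0 thr th12 thS; set L := loss _ _ _ _ _ _.
apply: (@le_trans _ _ (\sum_(j < n) (tsum F R c (fun r s t => tau r s t *+
      (window (theta j) (theta j.+1) (a r ^+ 2) +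
       window (theta j) (theta j.+1) (b s ^+ 2) +
       window (theta j) (theta j.+1) (g t ^+ 2))) + 24 * d * L))).
  apply: ler_sum => j _; apply: tsum_cut => //; first exact: thr.
  - exact: th12.
  - exact: thS.
have -> : (3000 + 24 * d * n%:R) * L = 3 * (1000 * L) + 24 * d * L * n%:R by ring.
rewrite big_split /= sumr_const card_ord -[_ *+ n]mulr_natr; apply: lerD => //.
have small := tsum_small tau a b g x y z x0 y0 z0 ha hb hg hc.
apply: le_trans (ler_wpM2l _ small) => //.
rewrite -tsum_sum -tsumZ; apply: ler_tsum => r s t e.
have [t0 _ _ _] := hc r s t e.
rewrite sumrMnr mulr_natl -mulrnA; apply: ler_wpMn2l => //.
have mono j : (j < n)%N -> theta j.+1 <= theta j.
  move=> jn; rewrite thS //; have t1 : theta j <= 1 by have := th12 j jn; lra.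
  have tj0 : 0 <= theta j by apply: le_trans (thr j jn); apply: ltW.
  rewrite (_ : _ * _ = d ^+ 2 * theta j ^+ 5 * theta j); last by ring.
  by rewrite ler_piMl // mulr_ile1 ?exprn_ile1 ?sqr_ge0 ?exprn_ge0.
have th v : ((v <= theta 0%N)%R <= (v <= 1/2)%R)%N.
  by case: (leP v (theta 0%N)) => // h; rewrite (le_trans h th0).
rewrite !big_split /=.
apply: leq_trans (leq_add (leq_add (sum_windows theta n (a r ^+ 2) mono)
  (sum_windows theta n (b s ^+ 2) mono)) (sum_windows theta n (g t ^+ 2) mono)) _.
have := th (a r ^+ 2); have := th (b s ^+ 2); have := th (g t ^+ 2).
by do 3 case: (_ <= theta 0%N); case: (a r ^+ 2 <= 1/2);
  case: (b s ^+ 2 <= 1/2); case: (g t ^+ 2 <= 1/2).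
Qed.
End LocalAnalysis.

(** * The residue tree *)

Section DigitTree.
Variables (p : nat) (pp : prime p).
Implicit Types (A B C : seq int) (r s t : 'F_p) (y e : int).
Implicit Types (P Q : int -> int -> int -> bool).

Definition child r A : seq int :=
  [seq (y %/ p)%Z | y <- A & ((y%:~R : 'F_p) == r)].

Definition rep r : int := (val r)%:Z.

Lemma intr_rep r : (rep r)%:~R = r.
Proof. by rewrite /rep -pmulrn; exact: natr_Zp. Qed.

Lemma p_intr0 : (p%:Z%:~R : 'F_p) = 0.
Proof. by apply/eqP; rewrite Fp_intr_eq0. Qed.

Lemma glue_intr r y : (y * p + rep r)%:~R = r.
Proof. by rewrite intrD intrM p_intr0 mulr0 add0r intr_rep. Qed.

Lemma rep_ge0 r : 0 <= rep r. Proof. by []. Qed.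

Lemma rep_lt r : rep r < p.
Proof. by rewrite /rep ltz_nat -[X in (_ < X)%N](Fp_cast pp); exact: ltn_ord. Qed.

Lemma glue_div r y : ((y * p + rep r) %/ p)%Z = y.
Proof.
rewrite divzMDl; last by rewrite eqz_nat -lt0n prime_gt0.
by rewrite divz_small ?addr0 // rep_ge0 /= rep_lt.
Qed.

Lemma div_glue y : y = (y %/ p)%Z * p + rep y%:~R.
Proof.
have e := divz_eq y p.
have em : y%:~R = (y %% p)%Z%:~R :> 'F_p.
  by rewrite {1}e intrD intrM p_intr0 mulr0 add0r.
rewrite {1}e; congr (_ + _).
have m0 : 0 <= (y %% p)%Z by rewrite modz_ge0 // eqz_nat -lt0n prime_gt0.
have m1 : (y %% p)%Z < p by rewrite ltz_pmod // ltz_nat prime_gt0.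
apply/eqP; rewrite -subr_eq0; apply/eqP; apply: (@small_dvdz p).
  by rewrite -Fp_intr_eq0 // intrB intr_rep em subrr.
have := rep_ge0 y%:~R; have := rep_lt y%:~R; move: m0 m1; lia.
Qed.

Lemma mem_child r A y : (y \in child r A) = (y * p + rep r \in A).
Proof.
apply/mapP/idP => [[x]|h].
  by rewrite mem_filter => /andP[/eqP <- xA] ->; rewrite -div_glue.
by exists (y * p + rep r); rewrite ?glue_div // mem_filter glue_intr eqxx.
Qed.

Lemma child_uniq r A : uniq A -> uniq (child r A).
Proof.
move=> uA; rewrite map_inj_in_uniq ?filter_uniq // => x y.
rewrite !mem_filter => /andP[/eqP ex _] /andP[/eqP ey _] e.
by rewrite (div_glue x) (div_glue y) e ex ey.
Qed.

Lemma sum_child (f : int -> nat) A :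
  (\sum_(y <- A) f y = \sum_r \sum_(y <- child r A) f (y * p + rep r)%R)%N.
Proof.
under [RHS]eq_bigr => r _ do rewrite big_map big_filter big_mkcond.
rewrite exchange_big /=; apply: eq_bigr => y _.
rewrite (bigD1 (y%:~R : 'F_p)) //= eqxx -div_glue big1 ?addn0 // => r.
by rewrite eq_sym => /negbTE ->.
Qed.

Lemma size_child A : (\sum_r size (child r A) = size A)%N.
Proof.
have := sum_child (fun=> 1%N) A; rewrite sum1_size => ->.
by apply: eq_bigr => r _; rewrite sum1_size.
Qed.

Definition nsum e A B C (P : int -> int -> int -> bool) : nat :=
  \sum_(y1 <- A) \sum_(y2 <- B) \sum_(y3 <- C) ((y1 + y2 + y3 == e)%R && P y1 y2 y3).

Lemma leq_nsum e A B C P Q : (forall y1 y2 y3, P y1 y2 y3 -> Q y1 y2 y3) ->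
  (nsum e A B C P <= nsum e A B C Q)%N.
Proof.
move=> h; apply: leq_sum => y1 _; apply: leq_sum => y2 _; apply: leq_sum => y3 _.
by case: (_ == _) => //=; case: (P _ _ _) (h y1 y2 y3) => // /(_ isT) ->.
Qed.

Lemma nsum_swap12 e A B C :
  nsum e A B C (fun _ _ _ => true) = nsum e B A C (fun _ _ _ => true).
Proof.
rewrite /nsum exchange_big; apply: eq_bigr => y1 _; apply: eq_bigr => y2 _.
by apply: eq_bigr => y3 _; rewrite [y2 + y1]addrC.
Qed.

Lemma nsum_swap23 e A B C :
  nsum e A B C (fun _ _ _ => true) = nsum e A C B (fun _ _ _ => true).
Proof.
apply: eq_bigr => y1 _; rewrite exchange_big; apply: eq_bigr => y2 _.
by apply: eq_bigr => y3 _; rewrite addrAC.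
Qed.

Lemma nsum_le e A B C P : uniq C -> (nsum e A B C P <= size A * size B)%N.
Proof.
move=> uC; apply: (@leq_trans (\sum_(y1 <- A) \sum_(y2 <- B) 1)%N); last first.
  by rewrite big_const_seq count_predT iter_addn_0 sum1_size mulnC.
apply: leq_sum => y1 _; apply: leq_sum => y2 _.
apply: (@leq_trans (\sum_(y3 <- C) (y3 == e - (y1 + y2))%R)%N).
  apply: leq_sum => y3 _; rewrite [y3 == _]eq_sym subr_eq [e == _]eq_sym addrC.
  by case: (_ == _) => //=; case: P.
rewrite (_ : (\sum_(y3 <- C) _)%N = count_mem (e - (y1 + y2)) C).
  by rewrite count_uniq_mem //; case: (_ \in _).
by rewrite -sum1_count [in RHS]big_mkcond; apply: eq_bigr => y3 _ /=; case: (_ == _).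
Qed.

(** The residues [r] and [s] determine [t], and the carry goes into the new right-hand side; this is
    why [nsum] has an arbitrary [e]. *)
Lemma nsum_split e A B C P : nsum e A B C P =
  (\sum_r \sum_s
    let t := (e%:~R - r - s)%R in
    nsum ((e - rep r - rep s - rep t) %/ p)%Z (child r A) (child s B) (child t C)
      (fun y1 y2 y3 =>
        P (y1 * p + rep r)%R (y2 * p + rep s)%R (y3 * p + rep t)%R))%N.
Proof.
rewrite /nsum sum_child; apply: eq_bigr => r _.
under eq_bigr => y1 _ do rewrite sum_child.
rewrite exchange_big; apply: eq_bigr => s _; apply: eq_bigr => y1 _.
apply: eq_bigr => y2 _; rewrite sum_child (bigD1 (e%:~R - r - s)) //=.
rewrite [X in (_ + X)%N]big1 ?addn0 => [|t ne]; last first.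
  apply: big1 => y3 _; case: eqP => //= he; case/eqP: ne.
  rewrite -he !intrD !intrM p_intr0 !mulr0 !add0r !intr_rep.
  by ring.
apply: eq_bigr => y3 _; congr (nat_of_bool (_ && _)).
set t := e%:~R - r - s.
have dv : (p %| e - rep r - rep s - rep t)%Z.
  rewrite -Fp_intr_eq0 // !intrB !intr_rep /t.
  by rewrite subrr.
set q := ((e - rep r - rep s - rep t) %/ p)%Z.
have eq : e = q * p + rep r + rep s + rep t.
  have := divzK dv; rewrite -/q => ->.
  by ring.
rewrite {1}eq.
have -> : y1 * p + rep r + (y2 * p + rep s) + (y3 * p + rep t) =
  (y1 + y2 + y3) * p + (rep r + rep s + rep t) by ring.
have -> : q * p + rep r + rep s + rep t = q * p + (rep r + rep s + rep t) by ring.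
have p0 : p%:Z != 0 by rewrite eqz_nat -lt0n prime_gt0.
by rewrite (inj_eq (addIr _)) (inj_eq (mulIf p0)).
Qed.
End DigitTree.

(** * The potential on the residue tree, and levels of flat splits *)

Section Potential.
Variables (R : realType) (p : nat) (pp : prime p) (rho : R).
Hypotheses (rho0 : 0 < rho) (rho1 : rho <= 1/2).
Hypothesis p_large : forall X : {set 'F_p},
  #|X|%:R <= 3 / rho -> (16 ^ #|X| < p)%N.
Implicit Types (A B C : seq int) (r s t : 'F_p) (y e : int) (h : R).

Local Notation child := (child p).
Local Notation rep := (rep p).
Local Notation any := (fun _ _ _ : int => true).

Lemma rect_Fp (X : {set 'F_p}) : #|X|%:R <= 3 / rho ->
  exists f, rectified 'F_p X f.
Proof. by move=> /p_large; apply: rectify. Qed.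

Definition sqrt_size A : R := Num.sqrt (size A)%:R.

(** The square root makes the shares of a nonempty list a unit vector. *)
Definition share A r : R := Num.sqrt ((size (child r A))%:R / (size A)%:R).

Definition root4 A : R := Num.sqrt (sqrt_size A).

Definition psi A B C : R := sqrt_size A * sqrt_size B * sqrt_size C *
  (sqrt_size A + sqrt_size B + sqrt_size C).

Lemma sqrt_size_ge0 A : 0 <= sqrt_size A. Proof. exact: sqrtr_ge0. Qed.

Lemma psi_ge0 A B C : 0 <= psi A B C.
Proof. by rewrite /psi !(mulr_ge0, addr_ge0) ?sqrt_size_ge0. Qed.

Lemma size_gt0R A : A != [::] -> 0 < (size A)%:R :> R.
Proof. by case: A => // x A _; rewrite ltr0n. Qed.

Lemma root4_gt0 A : A != [::] -> 0 < root4 A.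
Proof. by move=> A0; rewrite !sqrtr_gt0 size_gt0R. Qed.

Lemma root4_sqr A : root4 A ^+ 2 = sqrt_size A.
Proof. by rewrite sqr_sqrtr ?sqrt_size_ge0. Qed.

Lemma sqrt_size_sqr A : sqrt_size A ^+ 2 = (size A)%:R.
Proof. by rewrite sqr_sqrtr. Qed.

Lemma root4_exp4 A : root4 A ^+ 4 = (size A)%:R.
Proof. by rewrite (exprM _ 2 2) root4_sqr sqrt_size_sqr. Qed.

Lemma share_ge0 A r : 0 <= share A r. Proof. exact: sqrtr_ge0. Qed.

Lemma share_sqr A r : share A r ^+ 2 = (size (child r A))%:R / (size A)%:R.
Proof. by rewrite sqr_sqrtr // divr_ge0. Qed.

Lemma share_unitv A : A != [::] -> unitv 'F_p R (share A).
Proof.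
move=> A0; split=> [r|]; first exact: share_ge0.
under eq_bigr do rewrite share_sqr.
by rewrite -mulr_suml -natr_sum (size_child _ pp) divff // gt_eqF // size_gt0R.
Qed.

Lemma size_share A r : A != [::] ->
  (size (child r A))%:R = (size A)%:R * share A r ^+ 2 :> R.
Proof. by move=> A0; rewrite share_sqr mulrC divfK // gt_eqF // size_gt0R. Qed.

Lemma sqrt_size_child A r : A != [::] ->
  sqrt_size (child r A) = sqrt_size A * share A r.
Proof.
move=> A0; rewrite /sqrt_size (size_share _ _ A0) sqrtrM //.
by rewrite sqrtr_sqr ger0_norm // share_ge0.
Qed.

Definition child_rhs e r s t : int := ((e - rep r - rep s - rep t) %/ p)%Z.

Lemma nsum_tsum e A B C P : (nsum e A B C P)%:R =
  tsum 'F_p R (e%:~R) (fun r s t =>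
    (nsum (child_rhs e r s t) (child r A) (child s B) (child t C)
      (fun y1 y2 y3 => P (y1 * p + rep r) (y2 * p + rep s) (y3 * p + rep t)))%:R).
Proof.
rewrite (nsum_split _ pp) natr_sum; apply: eq_bigr => r _.
by rewrite natr_sum.
Qed.

Definition tau e A B C r s t : R :=
  (nsum (child_rhs e r s t) (child r A) (child s B) (child t C) any)%:R.

Lemma tau_capped e A B C : A != [::] -> B != [::] -> C != [::] ->
  uniq A -> uniq B -> uniq C ->
  capped 'F_p R (e%:~R) (tau e A B C) (share A) (share B) (share C)
    (root4 A) (root4 B) (root4 C).
Proof.
move=> A0 B0 C0 uA uB uC r s t _.
have uA' := child_uniq _ pp r A uA; have uB' := child_uniq _ pp s B uB.
have uC' := child_uniq _ pp t C uC.
have mulE (U V : seq int) u v : U != [::] -> V != [::] ->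
    root4 U ^+ 4 * root4 V ^+ 4 * (share U u ^+ 2 * share V v ^+ 2) =
    (size (child u U) * size (child v V))%N%:R.
  by move=> U0 V0; rewrite natrM !size_share // !root4_exp4; ring.
rewrite !mulE // /tau; split=> //; rewrite ler_nat.
- exact: nsum_le.
- by rewrite nsum_swap23; apply: nsum_le.
- by rewrite nsum_swap12 nsum_swap23; apply: nsum_le.
Qed.

Local Notation cont A B C r s t :=
  [&& rho < share A r ^+ 2, rho < share B s ^+ 2 & rho < share C t ^+ 2].

Definition lost e A B C : R := loss 'F_p R (e%:~R) rho
  (share A) (share B) (share C) (root4 A) (root4 B) (root4 C).

(** [sqrt_size] of a child is [sqrt_size] of the parent times the share, so each of the three terms
    of [psi], summed over the children, becomes an affinity of truncated shares. *)
Lemma psi_split e A B C : A != [::] -> B != [::] -> C != [::] ->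
  tsum 'F_p R (e%:~R) (fun r s t =>
    if cont A B C r s t then psi (child r A) (child s B) (child t C) else 0)
  = psi A B C - lost e A B C.
Proof.
move=> A0 B0 C0.
pose T := trunc 'F_p R rho.
have -> : psi A B C - lost e A B C = sqrt_size A * sqrt_size B * sqrt_size C *
   (sqrt_size A * affinity 'F_p R (T (share A)) (T (share B)) (T (share C)) (e%:~R)
  + sqrt_size B * affinity 'F_p R (T (share B)) (T (share A)) (T (share C)) (e%:~R)
  + sqrt_size C * affinity 'F_p R (T (share C)) (T (share A)) (T (share B)) (e%:~R)).
  by rewrite /psi /lost /loss !root4_sqr -/T; ring.
rewrite !affinityE [X in sqrt_size B * X]tsum_swap12.
rewrite [X in sqrt_size C * X]tsum_swap12 [X in sqrt_size C * X]tsum_swap23.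
rewrite -!tsumZ -!tsumD -tsumZ; apply: eq_tsum => r s t _.
rewrite /psi !sqrt_size_child // /T /trunc.
case: (rho < share A r ^+ 2); case: (rho < share B s ^+ 2);
  case: (rho < share C t ^+ 2) => /=; ring.
Qed.

(** The depth of the first flat split on the branch of [y], one whose child on the branch has
    relative size at most [h]. [None] says that there is none within [n] steps. *)
Fixpoint level h (n : nat) A y : option nat :=
  if n is n'.+1 then
    let A' := child (y%:~R) A in
    if (size A')%:R <= h * (size A)%:R then Some 0%N
    else omap S (level h n' A' (y %/ p)%Z)
  else None.

Lemma level_glue h n A r y : A != [::] -> level h n.+1 A (y * p + rep r) =
  if h < share A r ^+ 2 then omap S (level h n (child r A) y) else Some 0%N.
Proof.
move=> A0; rewrite /= (glue_intr _ pp) (glue_div _ pp) share_sqr.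
by rewrite ltr_pdivlMr ?size_gt0R // ltNge; case: ifP.
Qed.

Definition mismatch h n A B C y1 y2 y3 :=
  ~~ ((level h n A y1 == level h n B y2) && (level h n A y1 == level h n C y3)).

Definition unsettled h n A B C y1 y2 y3 :=
  [&& level h n A y1 == None, level h n B y2 == None & level h n C y3 == None].

Lemma nsum_false e A B C P : (forall y1 y2 y3, P y1 y2 y3 = false) ->
  nsum e A B C P = 0%N.
Proof.
move=> h; rewrite /nsum big1 // => y1 _; rewrite big1 // => y2 _.
by rewrite big1 // => y3 _; rewrite h andbF.
Qed.

Lemma eq_nsum e A B C P Q : (forall y1 y2 y3, P y1 y2 y3 = Q y1 y2 y3) ->
  nsum e A B C P = nsum e A B C Q.
Proof.
move=> h; rewrite /nsum; apply: eq_bigr => y1 _; apply: eq_bigr => y2 _.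
by apply: eq_bigr => y3 _; rewrite h.
Qed.

Lemma nsum_nil e A B C P : [|| A == [::], B == [::] | C == [::]] ->
  nsum e A B C P = 0%N.
Proof.
case/or3P => /eqP ->; rewrite /nsum; first by rewrite big_nil.
  by rewrite big1 // => y1 _; rewrite big_nil.
by rewrite big1 // => y1 _; rewrite big1 // => y2 _; rewrite big_nil.
Qed.

Lemma omap_S_eq (u v : option nat) : (omap S u == omap S v) = (u == v).
Proof. by case: u; case: v. Qed.

Definition spread n A := forall y y', y \in A -> y' \in A -> `|y - y'| < (p ^ n)%N%:Z.

Lemma spread_child n r A : spread n.+1 A -> spread n (child r A).
Proof.
move=> h y y'; rewrite !(mem_child _ pp) => yA y'A; have := h _ _ yA y'A.
have -> : y * p + rep r - (y' * p + rep r) = (y - y') * p by ring.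
rewrite normrM expnSr PoszM; have p0 : 0 < p%:Z by rewrite ltz_nat prime_gt0.
by rewrite (gtr0_norm p0) ltr_pM2r.
Qed.

Lemma spread0_size A : uniq A -> spread 0 A -> (size A <= 1)%N.
Proof.
case: A => [//|x [//|y A]] /= /andP[]; rewrite inE negb_or => /andP[/eqP xy _] _ h.
have := h x y; rewrite !inE !eqxx orbT => /(_ isT isT); rewrite expn0.
by move=> hxy; case: xy; lia.
Qed.

(** For a relative size v, the decrement of the logarithm is ln(1/v) <= 1/v - 1 = (1 - v)/v, and v
    exceeds rho. *)
Lemma ln_share A r : A != [::] -> rho < share A r ^+ 2 ->
  ln (size A)%:R <= ln (size (child r A))%:R + (1 - share A r ^+ 2) / rho :> R.
Proof.
move=> A0 hr; have sA := size_gt0R _ A0; have a0 := lt_trans rho0 hr.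
have sC : 0 < (size (child r A))%:R :> R by rewrite size_share // mulr_gt0.
rewrite -lerBlDl -ln_div ?posrE // size_share // invfM mulrA divff ?gt_eqF // mul1r.
set v := share A r ^+ 2 in hr a0 *.
have -> : v^-1 = 1 + (v^-1 - 1) by rewrite addrC subrK.
have v1 : v <= 1 by apply: unitv_le1; apply: share_unitv.
have iv1 : 1 <= v^-1 by rewrite invf_ge1.
apply: (le_trans (le_ln1Dx _)); first by apply: lt_le_trans (_ : 0 <= _); rewrite ?subr_ge0 // oppr_lt0.
have -> : v^-1 - 1 = (1 - v) / v by rewrite mulrBl divff ?gt_eqF // mul1r.
by rewrite ler_wpM2l ?subr_ge0 // lef_pV2 ?posrE // ltW.
Qed.

(** An entropy argument. The branch of an unsettled solution meets no flat split, yet [spread]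
    leaves at most one element of [A] after [n] steps. So the decrements of [ln] along the branch
    add up to the whole logarithm; [ln_share] bounds each, and [tsum_drop] charges them to the loss
    of potential. *)
Lemma unsettled_bound h n e A B C : rho <= h -> uniq A -> uniq B -> uniq C ->
  spread n A ->
  (nsum e A B C (unsettled h n A B C))%:R * ln (size A)%:R <=
  1000 / rho * psi A B C.
Proof.
move=> rh; have D0 : 0 <= 1000 / rho by rewrite divr_ge0 ?ler0n // ltW.
have drop e0 A0 B0 C0 (hA : A0 != [::]) (hB : B0 != [::]) (hC : C0 != [::])
    (uA : uniq A0) (uB : uniq B0) (uC : uniq C0) :=
  tsum_drop 'F_p R (e0%:~R) rho rho0 rho1 rect_Fp (tau e0 A0 B0 C0)
    (share A0) (share B0) (share C0) (root4 A0) (root4 B0) (root4 C0)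
    (root4_gt0 _ hA) (root4_gt0 _ hB) (root4_gt0 _ hC)
    (share_unitv _ hA) (share_unitv _ hB) (share_unitv _ hC)
    (tau_capped e0 A0 B0 C0 hA hB hC uA uB uC).
set k : R := 1000 in drop D0 *; clearbody k.
have DP A0 B0 C0 : 0 <= k / rho * psi A0 B0 C0.
  by apply: mulr_ge0 => //; exact: psi_ge0.
elim: n e A B C => [|n IH] e A B C uA uB uC spA.
  apply: le_trans (DP A B C); apply: mulr_ge0_le0; first exact: ler0n.
  by apply: ln_le0; rewrite (ler_nat _ _ 1); apply: spread0_size.
case: (boolP [|| A == [::], B == [::] | C == [::]]) => [h0|].
  by rewrite nsum_nil // mul0r.
rewrite !negb_or => /and3P[A0 B0 C0].
have {}drop := drop e A B C A0 B0 C0 uA uB uC; rewrite -/(lost e A B C) in drop.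
have -> : k / rho * psi A B C =
  rho^-1 * (k * lost e A B C) + k / rho * (psi A B C - lost e A B C) by ring.
have ir0 : 0 <= rho^-1 by rewrite invr_ge0 ltW.
apply: le_trans (lerD (ler_wpM2l ir0 drop) (lexx _)).
rewrite -(psi_split e) // -!tsumZ -tsumD nsum_tsum mulrC -tsumZ.
apply: ler_tsum => r s t _.
have u0 : 0 <= 1 - share A r ^+ 2.
  by rewrite subr_ge0; apply: unitv_le1; apply: share_unitv.
have t0 : 0 <= tau e A B C r s t by rewrite ler0n.
case: ifPn => [/and3P[hr _ _]|hcont]; last first.
  rewrite nsum_false ?mulr0 ?addr0 => [|y1 y2 y3].
    by apply: mulr_ge0 => //; apply: mulr_ge0.
  apply: contraNF hcont; rewrite /unsettled !level_glue //.
  case: ifPn => h1 //=; case: ifPn => h2 /=; last by rewrite andbF.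
  case: ifPn => h3 /= => [_|]; last by rewrite !andbF.
  by rewrite !(le_lt_trans rh).
set N := nsum _ _ _ _ _.
have N1 : N%:R <= tau e A B C r s t by rewrite ler_nat; apply: leq_nsum.
have N2 : (N <= nsum (child_rhs e r s t) (child r A) (child s B) (child t C)
    (unsettled h n (child r A) (child s B) (child t C)))%N.
  apply: leq_nsum => y1 y2 y3; rewrite /unsettled !level_glue //.
  by do 3 (case: ifP => _);
    case: (level _ _ _ y1); case: (level _ _ _ y2); case: (level _ _ _ y3).
have IHc := IH (child_rhs e r s t) (child r A) (child s B) (child t C)
  (child_uniq _ pp r A uA) (child_uniq _ pp s B uB) (child_uniq _ pp t C uC)
  (spread_child _ _ _ spA).
have sC : 1 <= (size (child r A))%:R :> R.
  have : 0 < (size (child r A))%:R :> R.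
    by rewrite size_share // mulr_gt0 ?size_gt0R // (lt_trans rho0).
  by rewrite ltr0n ler1n.
apply: (@le_trans _ _ ((ln (size (child r A))%:R + (1 - share A r ^+ 2) / rho) * N%:R)).
  by apply: ler_wpM2r; [exact: ler0n|exact: ln_share].
rewrite mulrDl addrC; apply: lerD.
  rewrite (_ : _ / rho * _ = rho^-1 * (N%:R * (1 - share A r ^+ 2))); last by ring.
  by apply: ler_wpM2l => //; apply: ler_wpM2r.
rewrite mulrC; apply: le_trans IHc; apply: ler_wpM2r; last by rewrite ler_nat.
exact: ln_ge0.
Qed.

Variables (theta : nat -> R) (J : nat) (d : R).
Hypotheses (d0 : 0 <= d) (d1 : d <= 1) (th0 : theta 0%N <= 1/2).
Hypothesis thr : forall j, (j < J)%N -> rho <= theta j.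
Hypothesis th12 : forall j, (j < J)%N -> theta j <= 1/2.
Hypothesis thS : forall j, (j < J)%N -> theta j.+1 = d ^+ 2 * theta j ^+ 6.

(** A mismatch is created where a triple of children splits at the threshold, or inherited from
    children all above it. The first kind is charged to the potential lost by [sum_tsum_cut]; for
    the second all relative sizes exceed [rho], so [psi_split] hands the remaining potential
    down. *)
Lemma mismatch_bound n e A B C : uniq A -> uniq B -> uniq C ->
  \sum_(j < J) (nsum e A B C (mismatch (theta j) n A B C))%:R <=
  (3000 + 24 * d * J%:R) * psi A B C.
Proof.
have hcut e0 A0 B0 C0 (hA : A0 != [::]) (hB : B0 != [::]) (hC : C0 != [::])
    (uA : uniq A0) (uB : uniq B0) (uC : uniq C0) :=
  sum_tsum_cut 'F_p R (e0%:~R) rho rho0 rho1 rect_Fp (tau e0 A0 B0 C0)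
    (share A0) (share B0) (share C0) (root4 A0) (root4 B0) (root4 C0) theta J d
    (root4_gt0 _ hA) (root4_gt0 _ hB) (root4_gt0 _ hC)
    (share_unitv _ hA) (share_unitv _ hB) (share_unitv _ hC)
    (tau_capped e0 A0 B0 C0 hA hB hC uA uB uC) d0 d1 th0 thr th12 thS.
have : 0 <= 3000 + 24 * d * J%:R.
  by apply: addr_ge0; [exact: ler0n|do 2 (apply: mulr_ge0; try exact: ler0n)].
move: (3000 + 24 * d * J%:R) hcut => D hcut D0.
have DP A0 B0 C0 : 0 <= D * psi A0 B0 C0 by apply: mulr_ge0 => //; exact: psi_ge0.
elim: n e A B C => [|n IH] e A B C uA uB uC.
  rewrite big1 // => j _.
  by rewrite nsum_false // => *; rewrite /mismatch /= eqxx.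
case: (boolP [|| A == [::], B == [::] | C == [::]]) => [h0|].
  by rewrite big1 // => j _; rewrite nsum_nil.
rewrite !negb_or => /and3P[A0 B0 C0].
have {}hcut := hcut e A B C A0 B0 C0 uA uB uC.
rewrite -/(lost e A B C) in hcut.
have -> : D * psi A B C = D * lost e A B C + D * (psi A B C - lost e A B C) by ring.
apply: le_trans (lerD hcut (lexx _)).
rewrite -(psi_split e) // -tsumZ -tsum_sum -tsumD.
under eq_bigr => j _ do rewrite nsum_tsum.
rewrite -tsum_sum; apply: ler_tsum => r s t _.
have IHc := IH (child_rhs e r s t) (child r A) (child s B) (child t C)
  (child_uniq _ pp r A uA) (child_uniq _ pp s B uB) (child_uniq _ pp t C uC).
apply: (@le_trans _ _ (\sum_(j < J) (tau e A B C r s t *+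
   splits R (theta j) (share A r ^+ 2) (share B s ^+ 2) (share C t ^+ 2) +
   if cont A B C r s t then
    (nsum (child_rhs e r s t) (child r A) (child s B) (child t C)
      (mismatch (theta j) n (child r A) (child s B) (child t C)))%:R else 0))).
  apply: ler_sum => j _; have hr := thr j (ltn_ord j).
  rewrite /splits.
  under eq_nsum do rewrite /mismatch !level_glue //.
  case: (boolP (theta j < share A r ^+ 2)) => h1;
  case: (boolP (theta j < share B s ^+ 2)) => h2;
  case: (boolP (theta j < share C t ^+ 2)) => h3 /=;
  rewrite ?mulr1n ?mulr0n ?add0r.
  - rewrite !(le_lt_trans hr) //= ler_nat; apply: leq_nsum => y1 y2 y3.
    by rewrite !omap_S_eq.
  - by rewrite -[X in X <= _]addr0 lerD //; [rewrite ler_nat; apply: leq_nsum|case: ifP].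
  - by rewrite -[X in X <= _]addr0 lerD //; [rewrite ler_nat; apply: leq_nsum|case: ifP].
  - by rewrite -[X in X <= _]addr0 lerD //; [rewrite ler_nat; apply: leq_nsum|case: ifP].
  - by rewrite -[X in X <= _]addr0 lerD //; [rewrite ler_nat; apply: leq_nsum|case: ifP].
  - by rewrite -[X in X <= _]addr0 lerD //; [rewrite ler_nat; apply: leq_nsum|case: ifP].
  - by rewrite -[X in X <= _]addr0 lerD //; [rewrite ler_nat; apply: leq_nsum|case: ifP].
  - by rewrite nsum_false //; case: ifP.
rewrite big_split /= lerD2l; case: ifP => _; last by rewrite mulr0 sumr_const mul0rn.
exact: IHc.
Qed.
End Potential.

(** * Solutions in sets of integers of given sizes *)

Section IntegerTriples.
Implicit Types (A B C : seq int) (e : int).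
Local Notation any := (fun _ _ _ : int => true).

Lemma perm_nsum e A A' B B' C C' P : perm_eq A A' -> perm_eq B B' -> perm_eq C C' ->
  nsum e A B C P = nsum e A' B' C' P.
Proof.
move=> hA hB hC; rewrite /nsum (perm_big _ hA); apply: eq_bigr => y1 _.
rewrite (perm_big _ hB); apply: eq_bigr => y2 _.
by rewrite (perm_big _ hC).
Qed.

(** The pairs of the hook have distinct sums: those containing [a] have sum at least [a + b], the
    others less. So each [y3] completes at most one pair. *)
Lemma hook_le e C a b A B : uniq C -> uniq (b :: B) -> uniq A ->
  all (fun y => y < a) A -> all (fun y => b <= y) B ->
  (\sum_(y3 <- C) (\sum_(y2 <- b :: B) (a + y2 + y3 == e)%R +
      \sum_(y1 <- A) (y1 + b + y3 == e)%R) <= size C)%N.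
Proof.
move=> uC uB uA hA hB; rewrite -[size C]sum1_size; apply: leq_sum => y3 _.
have s2 : (\sum_(y2 <- b :: B) (a + y2 + y3 == e)%R =
    ((e - y3 - a)%R \in b :: B) :> nat)%N.
  rewrite -(count_uniq_mem _ uB) -sum1_count [in RHS]big_mkcond.
  apply: eq_bigr => y _ /=; rewrite (_ : (_ == e) = (y == e - y3 - a)).
    by case: (_ == _).
  by rewrite -[in RHS]subr_eq0 -[in LHS]subr_eq0; congr (_ == _); ring.
have s1 : (\sum_(y1 <- A) (y1 + b + y3 == e)%R =
    ((e - y3 - b)%R \in A) :> nat)%N.
  rewrite -(count_uniq_mem _ uA) -sum1_count [in RHS]big_mkcond.
  apply: eq_bigr => y _ /=; rewrite (_ : (_ == e) = (y == e - y3 - b)).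
    by case: (_ == _).
  by rewrite -[in RHS]subr_eq0 -[in LHS]subr_eq0; congr (_ == _); ring.
rewrite s1 s2; case: (boolP (_ \in A)) => [/(allP hA) /= h1|_]; last by case: (_ \in _).
case: (boolP (_ \in _)) => //= h2.
have : b <= e - y3 - a.
  by move: h2; rewrite inE => /predU1P[->//|/(allP hB)].
by move: h1; lia.
Qed.

Lemma nsum_hook e t A B C : uniq C -> sorted (fun x y => y < x) A ->
  sorted <%R B -> (t <= size A)%N -> (t <= size B)%N ->
  (nsum e A B C any <= t * size C + (size A - t) * (size B - t))%N.
Proof.
move=> uC; elim: t A B => [|t IH] [|a A] [|b B] //= sA sB tA tB.
- by rewrite nsum_nil.
- by rewrite nsum_nil.
- by rewrite nsum_nil // orbT.
- by rewrite mul0n add0n !subn0; apply: nsum_le.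
have hA : all (fun y => y < a) A.
  by apply: (order_path_min (leT := fun x y => y < x)) sA => x y z; move=> h1 h2; apply: lt_trans h1.
have hB := order_path_min lt_trans sB.
have uB : uniq (b :: B) by apply: lt_sorted_uniq.
have uA : uniq A.
  have := path_sorted sA; apply: sorted_uniq => [x y z h1 h2|x]; last by rewrite ltxx.
  exact: lt_trans h1.
have hook := hook_le e C a b A B uC uB uA hA.
have {}hook := hook (sub_all (fun y => @ltW _ _ b y) hB).
have IH' := IH A B (path_sorted sA) (path_sorted sB) tA tB.
rewrite subSS mulSn -addnA; apply: leq_trans (leq_add hook IH').
rewrite /nsum big_cons big_split /= -addnA; apply: eq_leq; congr (_ + _)%N.
  rewrite exchange_big; apply: eq_bigr => y3 _; apply: eq_bigr => y2 _.
  by rewrite andbT.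
rewrite [X in (X + _)%N]exchange_big -big_split; apply: eq_bigr => y1 _ /=.
rewrite big_cons; congr (_ + _)%N; apply: eq_bigr => y3 _.
by rewrite andbT.
Qed.

Lemma nsum_hook_uniq e t A B C : uniq A -> uniq B -> uniq C ->
  (t <= size A)%N -> (t <= size B)%N ->
  (nsum e A B C any <= t * size C + (size A - t) * (size B - t))%N.
Proof.
move=> uA uB uC tA tB.
have pA : perm_eq A (rev (sort <=%R A)) by rewrite perm_sym perm_rev perm_sort.
have pB : perm_eq B (sort <=%R B) by rewrite perm_sym perm_sort.
rewrite (perm_nsum e _ _ _ _ _ _ _ pA pB (perm_refl C)).
rewrite (perm_size pA) (perm_size pB); apply: nsum_hook => //.
- by rewrite rev_sorted sort_lt_sorted.
- by rewrite sort_lt_sorted.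
- by rewrite -(perm_size pA).
- by rewrite -(perm_size pB).
Qed.

Lemma triangle_far (a b c T : nat) : (T <= a * b)%N -> (a + b <= c)%N ->
  (4 * T <= a * b + b * c + c * a + 1)%N.
Proof.
move=> hT /(leq_mul (leqnn (a + b)%N)).
case: (nat_AGM2 a b) => h _ h2; rewrite -mulnn in h; lia.
Qed.

(** Here [a] and [b] are sizes diminished by [t]. For [o = 0] the difference of the two sides is a
    nonnegative combination of the squares of a - b and a + b - 2t, plus 1; the summand 1 covers the
    rounding when [o = 1]. *)
Lemma triangle_near (a b c t o T : nat) : (o <= 1)%N -> (c + o = a + b)%N ->
  (T <= t * c + a * b)%N ->
  (4 * T <= (a + t) * (b + t) + (b + t) * c + c * (a + t) + 1)%N.
Proof.
move=> o1 ec hT; have sq (x : int) : 0 <= x * x by rewrite -expr2 sqr_ge0.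
have := sq (a%:Z - b%:Z); have := sq (a%:Z + b%:Z - 2 * t%:Z - 2 * o%:Z).
by case: o ec o1 => [|[|//]] ec _; nia.
Qed.

(** If one size is at least the sum of the other two, the product of those two is a good enough
    bound. Otherwise take as many hooks as minimise the bound, half of |A| + |B| - |C|. *)
Lemma nsum_triangle e A B C : uniq A -> uniq B -> uniq C ->
  (4 * nsum e A B C any <= size A * size B + size B * size C + size C * size A + 1)%N.
Proof.
move=> uA uB uC.
have [h1|h1] := leqP (size A + size B) (size C).
  by apply: triangle_far => //; apply: nsum_le.
have [h2|h2] := leqP (size C + size A) (size B).
  rewrite nsum_swap23 nsum_swap12.
  by apply: leq_trans (triangle_far _ _ _ _ (nsum_le e C A B any uB) h2) _; lia.
have [h3|h3] := leqP (size B + size C) (size A).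
  rewrite nsum_swap12 nsum_swap23.
  by apply: leq_trans (triangle_far _ _ _ _ (nsum_le e B C A any uA) h3) _; lia.
pose t := ((size A + size B - size C)./2)%N.
have ht : (size A + size B - size C = odd (size A + size B - size C) + t.*2)%N.
  by rewrite odd_double_half.
have := nsum_hook_uniq e t A B C uA uB uC.
move: (nsum _ _ _ _ _) ht h1 h2 h3 => T.
move: (size A) (size B) (size C) t (odd _) => a b c t o ht h1 h2 h3 h.
have tA : (t <= a)%N by case: o ht; lia.
have tB : (t <= b)%N by case: o ht; lia.
have := @triangle_near (a - t) (b - t) c t o T; rewrite !subnK //; apply.
- by case: o {ht}.
- by case: o ht; lia.
- exact: h.
Qed.

(* Colours are residues mod 12 and a triple with head colour d uses the colours
   d, d - 1, d - 5.  The differences 1, 4, 5 are distinct up to sign and prime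
   to 3, so each pair of colours is charged once and all pairs are tripartite. *)
Lemma twelve_colours (w : nat -> nat) :
  (3 * \sum_(d < 12) (w d * w ((d + 11) %% 12) + w ((d + 11) %% 12) * w ((d + 7) %% 12)
     + w ((d + 7) %% 12) * w d) <= (\sum_(d < 12) w d) ^ 2)%N.
Proof.
rewrite !big_ord_recr !big_ord0 /=.
move: (w 0%N) (w 1%N) (w 2%N) (w 3%N) (w 4%N) (w 5%N) (w 6%N) (w 7%N) (w 8%N)
  (w 9%N) (w 10%N) (w 11%N) => a0 a1 a2 a3 a4 a5 a6 a7 a8 a9 a10 a11.
pose x := (a0 + a3 + a6 + a9)%N; pose y := (a1 + a4 + a7 + a10)%N.
pose z := (a2 + a5 + a8 + a11)%N.
apply: (@leq_trans ((x + y + z) ^ 2)); last first.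
  by apply: eq_leq; congr (_ ^ _)%N; rewrite /x /y /z; lia.
apply: (@leq_trans (3 * (x * y + y * z + z * x))); last first.
  rewrite -mulnn; have [h1 _] := nat_Cauchy x y; have [h2 _] := nat_Cauchy y z.
  have [h3 _] := nat_Cauchy z x; rewrite -!mulnn in h1 h2 h3; lia.
(* The pairs added here, at distance 2 modulo 12, are exactly those between different classes modulo
   3 that the sum does not use. *)
rewrite leq_pmul2l //; apply: leq_trans (leq_addr
  (a0 * a2 + a1 * a3 + a2 * a4 + a3 * a5 + a4 * a6 + a5 * a7 + a6 * a8 + a7 * a9
   + a8 * a10 + a9 * a11 + a10 * a0 + a11 * a1) _) _.
by apply: eq_leq; rewrite /x /y /z; ring.
Qed.

(** The colour of [x1] fixes the classes of [x2] and [x3], so twelve applications of [nsum_triangle]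
    cover all solutions; their summands 1 add up to 36 = 3 * 12. *)
Lemma coloured_nsum (S : seq int) (col : int -> nat) (u v : int)
  (P : int -> int -> int -> bool) :
  uniq S -> u != 0 -> v != 0 -> (forall x : int, (col x < 12)%N) ->
  (forall x1 x2 x3 : int, P x1 (x2 * u) (x3 * v) ->
    col x2 = ((col x1 + 11) %% 12)%N /\ col x3 = ((col x1 + 7) %% 12)%N) ->
  (12 * nsum 0 S [seq (x * u)%R | x <- S] [seq (x * v)%R | x <- S] P <= size S ^ 2 + 36)%N.
Proof.
move=> uS u0 v0 col12 hP.
pose cls d := [seq x <- S | col x == d].
pose w d := size (cls d).
have ucls d : uniq (cls d) by apply: filter_uniq.
have umap (k : int) (s : seq int) : k != 0 -> uniq s -> uniq [seq x * k | x <- s].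
  by move=> k0 us; rewrite map_inj_uniq //; apply: mulIf.
have sw : (\sum_(d < 12) w d = size S)%N.
  rewrite -[RHS]sum1_size.
  rewrite (eq_bigr (fun d : 'I_12 => \sum_(x <- S) (col x == d)))%N; last first.
    move=> d _; rewrite /w /cls size_filter -sum1_count big_mkcond.
    by apply: eq_bigr => x _; case: (_ == _).
  rewrite exchange_big; apply: eq_bigr => x _.
  rewrite (bigD1 (Ordinal (col12 x))) //= eqxx big1 ?addn0 // => d.
  by rewrite -val_eqE /= eq_sym => /negbTE ->.
have cover : (nsum 0 S [seq (x * u)%R | x <- S] [seq (x * v)%R | x <- S] P <=
  \sum_(d < 12) nsum 0 (cls d) [seq (x * u)%R | x <- cls ((d + 11) %% 12)]
    [seq (x * v)%R | x <- cls ((d + 7) %% 12)] any)%N.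
  rewrite /nsum.
  under [X in (_ <= X)%N]eq_bigr => d _ do rewrite big_filter big_mkcond.
  rewrite [X in (_ <= X)%N]exchange_big; apply: leq_sum => x1 _ /=.
  rewrite (bigD1 (Ordinal (col12 x1))) //= eqxx; apply: leq_trans (leq_addr _ _).
  rewrite !big_map big_filter [X in (_ <= X)%N]big_mkcond.
  apply: leq_sum => x2 _; rewrite !big_map big_filter.
  case: ifP => h2; last first.
    rewrite big1 // => x3 _; case: (_ == _) => //=.
    by case: (boolP (P _ _ _)) => // /hP[e _]; rewrite e eqxx in h2.
  rewrite [X in (_ <= X)%N]big_mkcond; apply: leq_sum => x3 _.
  case: (_ == 0) => //=; case: (boolP (P _ _ _)) => // /hP[_ ->].
  by rewrite eqxx.
have step (d : 'I_12) : (4 * nsum 0 (cls d) [seq (x * u)%R | x <- cls ((d + 11) %% 12)]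
    [seq (x * v)%R | x <- cls ((d + 7) %% 12)] any <=
  w d * w ((d + 11) %% 12) + w ((d + 11) %% 12) * w ((d + 7) %% 12)
     + w ((d + 7) %% 12) * w d + 1)%N.
  apply: leq_trans (nsum_triangle 0 _ _ _ (ucls d) (umap _ _ u0 (ucls _))
    (umap _ _ v0 (ucls _))) _.
  by rewrite !size_map.
have : (4 * nsum 0 S [seq (x * u)%R | x <- S] [seq (x * v)%R | x <- S] P <=
  \sum_(d < 12) (w d * w ((d + 11) %% 12) + w ((d + 11) %% 12) * w ((d + 7) %% 12)
     + w ((d + 7) %% 12) * w d + 1))%N.
  apply: leq_trans (leq_mul (leqnn 4) cover) _.
  by rewrite big_distrr; apply: leq_sum => d _; apply: step.
have := twelve_colours w; rewrite sw [X in _ -> (_ <= X)%N -> _]big_split /=.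
by rewrite sum_nat_const card_ord; lia.
Qed.
End IntegerTriples.

(** * Levels under multiplication by p, and the asymptotic bound *)

Section LevelShift.
Variables (R : realType) (p : nat) (pp : prime p) (h : R).
Hypothesis h1 : h <= 1/2.
Implicit Types (A : seq int) (x y : int).

Lemma child0_scale A : child p 0 [seq x * p | x <- A] = A.
Proof.
have p0 : p%:Z != 0 by rewrite eqz_nat -lt0n prime_gt0.
rewrite /child filter_map -map_comp (eq_filter (a2 := predT)).
  by rewrite filter_predT map_id_in // => x _ /=; rewrite mulzK.
by move=> x /=; rewrite intrM (p_intr0 _ pp) mulr0 eqxx.
Qed.

(** Multiplication by [p] places above the tree one node with a single nonempty child, of relative
    size 1 > h, so the first flat split moves down by one. *)
Lemma level_scale n A y : A != [::] ->
  level R p h n.+1 [seq x * p | x <- A] (y * p) = omap S (level R p h n A y).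
Proof.
move=> A0; have p0 : p%:Z != 0 by rewrite eqz_nat -lt0n prime_gt0.
rewrite /= intrM (p_intr0 _ pp) mulr0 child0_scale size_map mulzK //.
rewrite ifF //; apply/negbTE; rewrite -ltNge.
have : 0 < (size A)%:R :> R by rewrite ltr0n; case: A A0.
by have := h1; nra.
Qed.

Lemma level_scale_pow j n A y : A != [::] ->
  level R p h (n + j) [seq x * p%:Z ^+ j | x <- A] (y * p%:Z ^+ j) =
  omap (addn j) (level R p h n A y).
Proof.
move=> A0; elim: j => [|j IH].
  rewrite addn0 expr0 mulr1 (eq_map (g := id)) ?map_id; last first.
    by move=> x; rewrite mulr1.
  by case: (level _ _ _ _ _ _).
have -> : [seq x * p%:Z ^+ j.+1 | x <- A] =
  [seq x * p | x <- [seq x * p%:Z ^+ j | x <- A]].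
  by rewrite -map_comp; apply: eq_map => x /=; rewrite exprSr mulrA.
rewrite addnS exprSr mulrA level_scale; last by case: A A0 {IH}.
by rewrite IH; case: (level _ _ _ _ _ _).
Qed.

Lemma level_fuel n m A y k : level R p h n A y = Some k ->
  level R p h (n + m) A y = Some k.
Proof.
elim: n A y k => [//|n IH] A y k /=; case: ifP => // _.
by case e: (level _ _ _ n _ _) => [k'|] // [<-]; rewrite (IH _ _ _ e).
Qed.

End LevelShift.

(** The levels of [x1], [x2], [x3] in [S] are k, k - 1, k - 5, and 11 and 7 are -1 and -5 modulo 12.
    Undoing the multiplications consumes 1 and 5 of the [n + 5] steps, which [level_fuel]
    restores. *)
Lemma settled_colours (R : realType) (p : nat) (h : R) (n k : nat) (S : seq int)
    (x1 x2 x3 : int) : prime p -> h <= 1/2 -> S != [::] ->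
  let col x := (odflt 0%N (level R p h (n + 5) S x) %% 12)%N in
  level R p h (n + 5) S x1 = Some k ->
  level R p h (n + 5) [seq x * p%:Z | x <- S] (x2 * p%:Z) = Some k ->
  level R p h (n + 5) [seq x * p%:Z ^+ 5 | x <- S] (x3 * p%:Z ^+ 5) = Some k ->
  col x2 = ((col x1 + 11) %% 12)%N /\ col x3 = ((col x1 + 7) %% 12)%N.
Proof.
move=> pp h1 S0 col l1 l2 l3.
move: l2; rewrite addnS (level_scale _ _ pp _ h1) //.
case e2: (level _ _ _ _ S x2) => [k2|] //= [ek2].
move: l3; rewrite (level_scale_pow _ _ pp _ h1) //.
case e3: (level _ _ _ n S x3) => [k3|] //= [ek3].
have e2' := level_fuel _ _ _ _ 1 _ _ _ e2; rewrite addn1 -addnS in e2'.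
have e3' := level_fuel _ _ _ _ 5 _ _ _ e3.
rewrite /col l1 e2' e3' /= -ek2; split; last by move: ek2; rewrite -ek3; lia.
by lia.
Qed.

(** * Choice of the parameters and conclusion *)

Section Thresholds.
Variables (R : realType) (d : R).
Hypotheses (d0 : 0 < d) (d1 : d <= 1).

(** Each value is the [l] that [tsum_cut] attaches to the preceding value as [h]. *)
Definition threshold n : R := iter n (fun x => d ^+ 2 * x ^+ 6) (1/2).

Lemma threshold_bounds n : 0 < threshold n <= 1/2.
Proof.
elim: n => [|n /andP[t0 t1]]; first by rewrite /threshold /= lexx andbT; lra.
rewrite /= mulr_gt0 ?exprn_gt0 //=.
have tt : threshold n <= 1 by lra.
rewrite -[threshold n ^+ 6]/(_ * threshold n ^+ 5) mulrCA.
rewrite -[X in _ <= X]mulr1; apply: ler_pM => //; first exact: ltW.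
  by rewrite mulr_ge0 ?exprn_ge0 // ltW.
by rewrite mulr_ile1 ?exprn_ile1 ?exprn_ge0 // ltW.
Qed.

Lemma threshold_le n m : (n <= m)%N -> threshold m <= threshold n.
Proof.
elim: m => [|m IH]; first by rewrite leqn0 => /eqP ->.
rewrite leq_eqVlt => /predU1P[->//|/IH]; apply: le_trans.
have /andP[t0 t1] := threshold_bounds m; have tt : threshold m <= 1 by lra.
rewrite /= -[threshold m ^+ 6]/(_ * threshold m ^+ 5) mulrCA.
apply: ler_piMr; first exact: ltW.
by rewrite mulr_ile1 ?exprn_ile1 ?exprn_ge0 // ltW.
Qed.

End Thresholds.

Lemma below_average (R : realType) (J : nat) (f : nat -> R) (X : R) : (0 < J)%N ->
  \sum_(j < J) f j <= J%:R * X -> exists2 j, (j < J)%N & f j <= X.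
Proof.
move=> J0 h; case: (boolP [exists j : 'I_J, f j <= X]) => [/existsP[j hj]|].
  by exists j.
rewrite negb_exists => /forallP hX; exfalso.
have : 0 < \sum_(j < J) (f j - X).
  case: J J0 h hX => // J _ _ hX; rewrite big_ord_recl ltr_pwDl //.
    by rewrite subr_gt0 ltNge; exact: hX.
  by apply: sumr_ge0 => j _; rewrite subr_ge0 ltW // ltNge; apply: hX.
by rewrite sumrB sumr_const card_ord -mulr_natl subr_gt0 ltNge h.
Qed.

Lemma psi_square (R : realType) (A B C : seq int) :
  size B = size A -> size C = size A ->
  psi R A B C = 3 * (size A)%:R ^+ 2.
Proof.
move=> eB eC; rewrite /psi /sqrt_size eB eC.
set g := Num.sqrt _; have -> : (size A)%:R = g ^+ 2 :> R by rewrite sqr_sqrtr.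
ring.
Qed.

Lemma exists_spread (p : nat) (S : seq int) : (1 < p)%N ->
  exists n, spread p (n + 5) S.
Proof.
move=> p1; exists (\sum_(y <- S) `|y|%N + \sum_(y <- S) `|y|%N)%N => y y' yS y'S.
have le_sum z : z \in S -> (`|z|%N <= \sum_(y <- S) `|y|%N)%N.
  by move=> zS; rewrite (big_rem z zS) /= leq_addr.
have := le_sum _ yS; have := le_sum _ y'S; set m := (\sum_(_ <- _) _)%N.
have := ltn_expl (m + m + 5) p1; move: (p ^ _)%N => q; lia.
Qed.

Lemma nsum_cover (e : int) (A B C : seq int) (any P Q T : int -> int -> int -> bool) :
  (forall y1 y2 y3, [|| P y1 y2 y3, Q y1 y2 y3 | T y1 y2 y3]) ->
  (nsum e A B C any <= nsum e A B C P + nsum e A B C Q + nsum e A B C T)%N.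
Proof.
move=> h; rewrite /nsum -!big_split; apply: leq_sum => y1 _.
rewrite -!big_split; apply: leq_sum => y2 _.
rewrite -!big_split; apply: leq_sum => y3 _ /=; move: (h y1 y2 y3).
by case: (_ == e) => //=; case: (any _ _ _); case: (P _ _ _); case: (Q _ _ _) => //= ->.
Qed.

(** [J] makes 3k/J <= eps/4 and [d] makes 72d <= eps/4; [rho] is the last threshold, [p] is large in
    terms of [rho], and [N] in terms of [rho] and [eps]. In units of |S|^2, mismatched solutions
    contribute eps/2, unsettled ones eps/4, settled ones 1/12 + eps/4. *)
Lemma nsum_asymptotic (R : realType) (eps : R) : 0 < eps ->
  exists2 p : nat, prime p & exists N : nat, forall S : seq int, uniq S ->
    (N <= size S)%N ->
    (nsum 0 S [seq x * p%:Z | x <- S] [seq x * p%:Z ^+ 5 | x <- S]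
       (fun _ _ _ => true))%:R <= (1 / 12 + eps) * (size S)%:R ^+ 2.
Proof.
move=> e0.
have [k kE k0] : exists2 k : R, k = 3000 & 0 < k by exists 3000; rewrite ?ltr0n.
have [l lE l0] : exists2 l : R, l = 1000 & 0 < l by exists 1000; rewrite ?ltr0n.
have ie0 : 0 < eps^-1 by rewrite invr_gt0.
pose J := Num.bound (12 * k * eps^-1).
have hJ : 12 * k * eps^-1 < J%:R by apply: archi_boundP; rewrite !mulr_ge0 // ltW.
have J0 : (0 < J)%N.
  by rewrite -(ltr0n R); apply: le_lt_trans hJ; rewrite !mulr_ge0 // ltW.
pose d := Num.min 1 (eps / 288).
have d0 : 0 < d by rewrite lt_min ltr01; apply: divr_gt0; [exact: e0|rewrite ltr0n].
have d1 : d <= 1 by rewrite ge_min lexx.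
have d2 : d <= eps / 288 by rewrite ge_min lexx orbT.
pose theta := threshold R d; pose rho := theta J.
have th n : 0 < theta n <= 1/2 by apply: threshold_bounds.
have /andP[rho0 rho1] := th J; rewrite -/rho in rho0 rho1.
have [p pM pp] := prime_above (16 ^ Num.bound (3 / rho))%N.
have p_large (X : {set 'F_p}) : #|X|%:R <= 3 / rho -> (16 ^ #|X| < p)%N.
  move=> hX; apply: leq_ltn_trans pM; rewrite leq_pexp2l // -(ler_nat R).
  by apply: (le_trans hX); apply/ltW/archi_boundP; rewrite divr_ge0 ?ler0n // ltW.
have p0 : p%:Z != 0 by rewrite eqz_nat -lt0n prime_gt0.
exists p => //.
exists (maxn (Num.bound (expR (12 * l / (rho * eps)))) (maxn 1 (Num.bound (12 / eps)))).
move=> S uS; rewrite !geq_max => /and3P[hN1 hN2 hN3].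
have S0 : S != [::] by case: (S) hN2.
have [n spn] := exists_spread p S (prime_gt1 pp).
set B := [seq x * p%:Z | x <- S]; set C := [seq x * p%:Z ^+ 5 | x <- S].
have uB : uniq B by rewrite map_inj_uniq //; apply: mulIf.
have uC : uniq C by rewrite map_inj_uniq //; apply: mulIf; rewrite expf_neq0.
have sB : size B = size S by rewrite size_map.
have sC : size C = size S by rewrite size_map.
have psiE := psi_square R S B C sB sC.
have mis := mismatch_bound R p pp rho rho0 rho1 p_large theta J d (ltW d0) d1
  (proj2 (andP (th 0%N))) (fun j jJ => threshold_le R d d0 d1 j J (ltnW jJ))
  (fun j _ => proj2 (andP (th j))) (fun j _ => erefl) (n + 5) 0 S B C uS uB uC.
rewrite psiE -kE in mis.
pose X := eps / 2 * (size S)%:R ^+ 2.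
have N0 : 1 <= (size S)%:R :> R by rewrite ler1n.
have sq0 : 0 < (size S)%:R ^+ 2 :> R by rewrite exprn_gt0 // ltr0n.
have misX : \sum_(j < J) (nsum 0 S B C (mismatch R p (theta j) (n + 5) S B C))%:R
    <= J%:R * X.
  apply: (le_trans mis); rewrite /X.
  have -> : (k + 24 * d * J%:R) * (3 * (size S)%:R ^+ 2) =
    (3 * k + 72 * d * J%:R) * (size S)%:R ^+ 2 by ring.
  rewrite mulrA; apply: ler_wpM2r; first exact: ltW.
  have jk : 12 * k <= J%:R * eps.
    by have := ltW hJ; rewrite ler_pdivrMr.
  have jd : 72 * d * J%:R <= eps / 4 * J%:R.
    by apply: ler_wpM2r; [exact: ler0n|lra].
  have -> : J%:R * (eps / 2) = J%:R * eps / 4 + eps / 4 * J%:R by field.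
  apply: lerD => //; rewrite ler_pdivlMr //; lra.
(* The threshold chosen by the pigeonhole principle may depend on [S]; [p] and [N] do not. *)
have [j jJ hj] := below_average R J
  (fun j => (nsum 0 S B C (mismatch R p (theta j) (n + 5) S B C))%:R) X J0 misX.
have rj : rho <= theta j by apply: (threshold_le R d d0 d1); apply: ltnW.
have /andP[_ tj] := th j.
have uns := unsettled_bound R p pp rho rho0 rho1 p_large (theta j) (n + 5) 0 S B C
  rj uS uB uC spn.
rewrite psiE -lE in uns.
have hln : 12 * l / (rho * eps) <= ln (size S)%:R.
  rewrite -[X in X <= _]expRK ler_ln ?posrE; [|exact: expR_gt0|by rewrite ltr0n].
  apply: le_trans (ltW (archi_boundP (expR_ge0 _))) _.
  by rewrite ler_nat.
have unsX : (nsum 0 S B C (unsettled R p (theta j) (n + 5) S B C))%:R <=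
    eps / 4 * (size S)%:R ^+ 2.
  have L0 : 0 < 12 * l / (rho * eps) by apply: divr_gt0; apply: mulr_gt0.
  rewrite -(ler_pM2r L0).
  apply: (@le_trans _ _ (l / rho * (3 * (size S)%:R ^+ 2))).
    by apply: le_trans uns; apply: ler_wpM2l.
  by rewrite le_eqVlt; apply/orP; left; apply/eqP; field; rewrite !gt_eqF.
pose lev A y := level R p (theta j) (n + 5) A y.
pose settled y1 y2 y3 :=
  [&& lev S y1 == lev B y2, lev S y1 == lev C y3 & lev S y1 != None].
pose col x := (odflt 0%N (lev S x) %% 12)%N.
have hset : (12 * nsum 0 S B C settled <= size S ^ 2 + 36)%N.
  apply: (coloured_nsum S col) => //; first by rewrite expf_neq0.
    by move=> x; rewrite ltn_mod.
  move=> x1 x2 x3 /and3P[/eqP l2 /eqP l3].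
  case l1: (lev S x1) => [m|//] _; rewrite l1 in l2 l3.
  by apply: (settled_colours R p (theta j) n m) => //; symmetry.
have cov := nsum_cover 0 S B C (fun _ _ _ => true)
  (mismatch R p (theta j) (n + 5) S B C) (unsettled R p (theta j) (n + 5) S B C)
  settled.
have {cov} : (nsum 0 S B C (fun _ _ _ => true))%:R <=
    (nsum 0 S B C (mismatch R p (theta j) (n + 5) S B C))%:R +
    (nsum 0 S B C (unsettled R p (theta j) (n + 5) S B C))%:R +
    (nsum 0 S B C settled)%:R :> R.
  rewrite -!natrD ler_nat; apply: cov => y1 y2 y3.
  rewrite /mismatch /unsettled /settled -/(lev S y1) -/(lev B y2) -/(lev C y3).
  case: eqP => [<-|] //=; case: eqP => [<-|] //=.
  by case: (lev S y1).
have {hset} : 12 * (nsum 0 S B C settled)%:R <= (size S)%:R ^+ 2 + 36 :> R.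
  by rewrite -natrX -natrM -natrD ler_nat.
have N3 : 12 / eps <= (size S)%:R ^+ 2.
  apply: (@le_trans _ _ (size S)%:R); last by rewrite expr2 ler_peMr // ler0n.
  apply: le_trans (ltW (archi_boundP _)) _; first by rewrite mulr_ge0 // ltW.
  by rewrite ler_nat.
rewrite ler_pdivrMr // in N3.
move: hj unsX N3; rewrite /X; set T := (nsum _ _ _ _ (fun _ _ _ => true))%:R.
set M := (nsum _ _ _ _ (mismatch _ _ _ _ _ _ _))%:R.
set U := (nsum _ _ _ _ (unsettled _ _ _ _ _ _ _))%:R.
set V := (nsum _ _ _ _ settled)%:R; set Q := (size S)%:R ^+ 2.
clearbody T M U V Q; clear -e0.
rewrite mulrC => h1 h2 h3 h4 h5; have -> : (1/12 + eps) * Q = Q / 12 + eps * Q by field.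
have e1 : eps / 2 * Q = eps * Q / 2 by field.
have e2 : eps / 4 * Q = eps * Q / 4 by field.
lra.
Qed.

Lemma nsol_nsum (u v : int) (S : {fset int}) :
  nsol 1 u v S = nsum 0 S [seq x * u | x <- S] [seq x * v | x <- S]
    (fun _ _ _ => true).
Proof.
pose L := [seq (xy, z) | xy <- [seq (x, y) | x <- S, y <- S], z <- S].
pose P (w : int * int * int) := 1 * w.1.1 + u * w.1.2 + v * w.2 == 0.
have uL : uniq L.
  apply: allpairs_uniq; rewrite ?fset_uniq //; last by move=> [? ?] [? ?] _ _ [-> ->].
  by apply: allpairs_uniq; rewrite ?fset_uniq // => - [? ?] [? ?] _ _ [-> ->].
have -> : nsol 1 u v S = count P L.
  rewrite /nsol -size_filter; apply: perm_size; apply: uniq_perm.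
  - exact: fset_uniq.
  - exact: filter_uniq.
  move=> [[x y] z]; rewrite mem_filter !inE /= andbC; congr (_ && _).
  apply/idP/allpairsP => [/andP[/andP[xS yS] zS]|[[[x' y'] z'] /= [xy zS [-> -> ->]]]].
    by exists ((x, y), z); split=> //=; apply/allpairsP; exists (x, y).
  by case/allpairsP: xy => -[x1 y1] /= [x1S y1S [-> ->]]; rewrite x1S y1S.
rewrite -sum1_count big_mkcond /L big_allpairs_dep big_allpairs_dep /nsum.
apply: eq_bigr => x _; rewrite big_map; apply: eq_bigr => y _.
rewrite big_map; apply: eq_bigr => z _.
by rewrite /P /= mul1r [u * y]mulrC [v * z]mulrC andbT; case: (_ == _).
Qed.

Lemma gamma_le (R : realType) (a1 a2 a3 : int) (k : R) (N : nat) :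
  (forall S : {fset int}, (N <= #|` S|)%N -> sol_ratio R a1 a2 a3 S <= k) ->
  (gamma R a1 a2 a3 <= k%:E)%E.
Proof.
move=> hN; apply: lime_le.
  apply: ereal_nonincreasing_is_cvgn => m n mn; apply: le_ereal_sup.
  by move=> _ [S /= nS <-]; exists S => //; apply: leq_trans nS.
exists N => // n /= Nn; apply: ge_ereal_sup => _ [S /= nS <-].
by rewrite lee_fin; apply: hN; apply: leq_trans nS.
Qed.

Theorem theorem1p4 (R : realType) (eps : R) (heps : 0 < eps) :
  exists a1 a2 a3 : int,
    [/\ a1 != 0, a2 != 0, a3 != 0,
        gcdz (gcdz a1 a2) a3 = 1
      & (gamma R a1 a2 a3 <= (1 / 12%:R + eps)%:E)%E].
Proof.
have [p pp [N hN]] := nsum_asymptotic R eps heps.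
have p0 : p%:Z != 0 by rewrite eqz_nat -lt0n prime_gt0.
exists 1, p%:Z, (p%:Z ^+ 5); split=> //; first by rewrite expf_neq0.
  by rewrite !gcd1z.
(* The lower bound 1 excludes the empty set, so that the denominator can be cleared. *)
apply: (gamma_le _ _ _ _ _ (maxn N 1)) => S; rewrite geq_max => /andP[NS S0].
rewrite /sol_ratio nsol_nsum ler_pdivrMr; last by rewrite exprn_gt0 // ltr0n.
exact: hN (fset_uniq S) NS.
Qed.
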